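(* Let $A$ be a self-adjoint operator acting on $\mathcal{H}=L^2(X,V)$ and let $\Omega\subset X$ be a measurable set. Let $$N_\Omega(\lambda)=\sup\{\dim L \mid \operatorname{supp} L\subset\Omega \text{ and } \mathcal{E}\le\lambda \text{ on } L\}$$ denote the Dirichlet spectral distribution function of $A$ in $\Omega$, and put $\varphi_\Omega(y)=\int_0^y F_\Omega^{-1}(u)\,du$. Then one has $$\varphi_\Omega(N_\Omega(\lambda))\le \lambda\,N_\Omega(\lambda).$$ If moreover $A$ is positive, then $$N_\Omega(\lambda)\le 2F_\Omega(2\lambda).$$
   Context: $(X,\mu)$ is a $\sigma$-finite measure space, $V$ a separable Hilbert space, and $\mathcal{H}=L^2(X,V)=L^2(X,\mu)\otimes V$. $\tau$ is the usual trace on operators of $\mathcal{H}$ and $\chi_\Omega$ is multiplication by the indicator function of $\Omega$. $\Pi_\lambda=\Pi_{]-\infty,\lambda[}(A)$ is the spectral projection of $A$ on the open half line, and $F_\Omega(\lambda)=\tau(\Pi_\lambda\chi_\Omega\Pi_\lambda)$ is the spectral measure of $\Omega$. For an increasing (in the large sense) function $\varphi$ on $\mathbb{R}$ with non-negative values and $y\ge0$, $\varphi^{-1}(y)=\sup\{x\in\mathbb{R}\mid\varphi(x)\le y\}\in[-\infty,+\infty]$. In the definition of $N_\Omega(\lambda)$, $L$ ranges over linear subspaces of $\mathcal{H}$ consisting of functions supported in $\Omega$, and ''$\mathcal{E}\le\lambda$ on $L$'' means that the energy $\mathcal{E}(f)=\langle Af,f\rangle$ (in the quadratic form sense) satisfies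 $\mathcal{E}(f)\le\lambda\|f\|_2^2$ for every $f\in L$. If $N_\Omega(\lambda)=+\infty$, $\varphi_\Omega(+\infty)$ is read as $\lim_{y\to+\infty}\varphi_\Omega(y)$ and $0\cdot\infty=0$.
   Formalization: The second inequality is proved for λ ≠ 0 when A is non-negative, and for every λ when A is strictly positive; at λ = 0 it fails for A = 0, since N_Ω(0) = dim L²(Ω,V) while F_Ω(0) = 0. *)

(* Defs.v *)
From HB Require Import structures.
From mathcomp Require Import all_boot all_order all_algebra ring_quotient.
From mathcomp Require Import all_classical all_reals all_analysis.
From mathcomp Require Import measurable_realfun.
From mathcomp Require Import complex.
From mathcomp Require Import ring lra.

Set Implicit Arguments.
Unset Strict Implicit.
Unset Printing Implicit Defensive.

Import Order.TTheory GRing.Theory Num.Theory numFieldNormedType.Exports.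

Local Open Scope classical_set_scope.
Local Open Scope ring_scope.

HB.mixin Record isSeparableHilbert (R : realType) V
    of CompleteNormedModule R[i] V := {
  inner : {dot V for (@Num.conj R[i])} ;
  inner_normE : forall v : V, `|v| ^+ 2 = inner v v ;
  separable : exists D : set V, countable D /\ dense D
}.

#[short(type="separableHilbertType")]
HB.structure Definition SeparableHilbert (R : realType) :=
  {V of isSeparableHilbert R V & CompleteNormedModule R[i] V}.

Notation Re := (@complex.Re _).
Notation Im := (@complex.Im _).

Section complex_facts.
Context (R : realType).
Implicit Types z w : R[i].

Lemma cReD z w : Re (z + w) = Re z + Re w.
Proof. by case: z; case: w. Qed.

Lemma cReN z : Re (- z) = - Re z.
Proof. by case: z. Qed.

Lemma cImD z w : Im (z + w) = Im z + Im w.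
Proof. by case: z; case: w. Qed.

Lemma cReM z w : Re (z * w) = Re z * Re w - Im z * Im w.
Proof. by case: z; case: w. Qed.

Lemma cImM z w : Im (z * w) = Re z * Im w + Im z * Re w.
Proof. by case: z; case: w. Qed.

Lemma cReJ z : Re (Num.conj z) = Re z.
Proof. by case: z. Qed.

Lemma cImJ z : Im (Num.conj z) = - Im z.
Proof. by case: z. Qed.

Lemma ge0_cRe z : 0 <= z -> 0 <= Re z.
Proof. by rewrite lecE => /andP[]. Qed.

Lemma cReK z : z \is Num.real -> (Re z)%:C%C = z.
Proof. exact: RRe_real. Qed.

End complex_facts.

Section hilbert_facts.
Context (R : realType) (V : separableHilbertType R).
Implicit Types u v : V.

Definition sqnorm v : R := Re (inner v v).

Lemma sqnorm_ge0 v : 0 <= sqnorm v.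
Proof. by apply: ge0_cRe; rewrite -inner_normE exprn_ge0. Qed.

Lemma sqnormE v : sqnorm v = Re `|v| ^+ 2.
Proof.
rewrite /sqnorm -inner_normE expr2 cReM -expr2.
have : `|v| \is Num.real by exact: normr_real.
by move=> /cReK <- /=; rewrite mulr0 subr0.
Qed.

Lemma norm_ltC v (r : R) : (`|v| < r%:C%C) = (Re `|v| < r).
Proof. by rewrite -{1}(cReK (normr_real v)) ltcR. Qed.

Lemma sqnorm_eq0 v : (sqnorm v == 0) = (v == 0).
Proof.
rewrite sqnormE sqrf_eq0 -(normr_eq0 v) -{2}(cReK (normr_real v)).
by rewrite eq_complex /= eqxx andbT.
Qed.

Lemma inner_Re u v : Re (inner u v) = 4^-1 * (sqnorm (u + v) - sqnorm (u - v)).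
Proof.
rewrite /sqnorm (dnormB _ u v) (dnormD _ u v) !(cReD, cReN, cReJ); by field.
Qed.

Lemma inner_Im u v : Im (inner u v) = Re (inner u ('i%C *: v)).
Proof. by rewrite linearZr_LR /= cReM /=; case: (inner u v) => a b /=; ring. Qed.

Lemma sqnormZ (a : R[i]) v : sqnorm (a *: v) = Re (`|a| ^+ 2) * sqnorm v.
Proof.
rewrite /sqnorm dnormZ cReM -(cReK (normr_real a)) -rmorphXn /=.
by rewrite mul0r subr0.
Qed.

Lemma sqnormD_le u v : sqnorm (u + v) <= 2 * (sqnorm u + sqnorm v).
Proof.
have := sqnorm_ge0 (u - v).
rewrite /sqnorm (dnormB _ u v) (dnormD _ u v) !(cReD, cReN, cReJ); lra.
Qed.

Lemma normr_inner_Re u v : `|Re (inner u v)| <= sqnorm u + sqnorm v.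
Proof.
have := sqnorm_ge0 (u - v); have := sqnorm_ge0 (u + v).
have := sqnorm_ge0 u; have := sqnorm_ge0 v.
rewrite /sqnorm (dnormB _ u v) (dnormD _ u v) !(cReD, cReN, cReJ) => *.
by rewrite ler_norml; apply/andP; split; lra.
Qed.

Lemma dense_seq : exists q : nat -> V,
  forall v (e : R), 0 < e -> exists n, `|v - q n| < e%:C%C.
Proof.
have [D [cD dD]] := @separable R V.
have bD v (e : R) : 0 < e -> exists2 d, D d & `|v - d| < e%:C%C.
  move=> e0; have [|d []] := dD (ball v e%:C%C) _ (ball_open _ _).
    by exists v; apply: ballxx; rewrite ltcR.
  by rewrite -ball_normE => ? ?; exists d.
have [d0 Dd0 _] := bD 0 1 ltr01.
have /pcard_surjP[q surq] := cD.
exists q => v e e0; have [d Dd vd] := bD v e e0.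
by have [n _ qn] := surq d Dd; exists n; rewrite qn.
Qed.

End hilbert_facts.

Section borel.
Context d (X : measurableType d) (R : realType) (V : separableHilbertType R).
Implicit Types f g h : X -> V.

(* V is separable: Borel, weak and strong measurability coincide. *)
Definition borel_fun f :=
  measurable_fun [set: X] (f : X -> g_sigma_algebraType (@open V)).

Lemma borel_ball h (c : V) (r : R) : borel_fun h ->
  measurable [set x | `|h x - c| < r%:C%C].
Proof.
move=> mh.
have := mh measurableT (ball c r%:C%C).
rewrite setTI (_ : _ @^-1` _ = [set x | `|h x - c| < r%:C%C]); last first.
  by apply/seteqP; split => x; rewrite /= -ball_normE /= distrC.
by apply; apply: sub_sigma_algebra; exact: ball_open.
Qed.

Lemma ball_borel h :
  (forall (c : V) (r : R), measurable [set x | `|h x - c| < r%:C%C]) ->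
  borel_fun h.
Proof.
move=> mh; apply: (@measurability _ _ X (g_sigma_algebraType (@open V)) setT h (@open V)) => // _ [U oU <-].
have [q dq] := dense_seq V.
pose inO n m := `[< ball (q n) (m.+1%:R^-1)%:C%C `<=` U >].
rewrite setTI (_ : _ @^-1` _ = \bigcup_n \bigcup_(m in [set m | inO n m])
    [set x | `|h x - q n| < (m.+1%:R^-1)%:C%C]); last first.
  apply/seteqP; split => [x Ux|x [n _ [m /asboolP sub hx]]]; last first.
    by apply: sub; rewrite -ball_normE /= distrC.
  have /nbhs_ballP[e /= e0 be] : nbhs (h x) U by exact: open_nbhs_nbhs.
  have eE : (Re e)%:C%C = e by apply: cReK; exact: gtr0_real.
  have e0' : 0 < Re e by rewrite -ltcR eE.
  have [m me] : exists m : nat, m.+1%:R^-1 < Re e / 2.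
    have e2 : 0 < Re e / 2 by rewrite divr_gt0.
    have [m _ H] := near_infty_natSinv_lt (PosNum e2).
    by exists m; by have := H m; apply => /=.
  have [|n hn] := dq (h x) m.+1%:R^-1; first by rewrite invr_gt0.
  exists n => //; exists m => //; apply/asboolP => y.
  rewrite -ball_normE /= => qy; apply: be; rewrite -ball_normE /=.
  rewrite -eE -(subrKA (q n)) (le_lt_trans (ler_normD _ _))//.
  rewrite (lt_trans (ltrD hn qy))// -rmorphD ltcR -mulr2n -[_ *+ 2]mulr_natr.
  by rewrite -ltr_pdivlMr.
by apply: bigcupT_measurable => n; apply: bigcup_measurable => m _; exact: mh.
Qed.

Lemma borel_funD f g : borel_fun f -> borel_fun g -> borel_fun (f + g).
Proof.
move=> mf mg; apply: ball_borel => c r.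
have [q dq] := dense_seq V.
have fgE x n : (f + g) x - c = (f x - q n) + (g x - (c - q n)).
  rewrite opprB [g x + _]addrCA subrKA. by rewrite addrA.
rewrite (_ : mkset _ = \bigcup_n \bigcup_m
   ([set x | `|f x - q n| < (m.+1%:R^-1)%:C%C] `&`
    [set x | `|g x - (c - q n)| < (r - m.+1%:R^-1)%:C%C])); last first.
  apply/seteqP; split => [x /= fgr|x [n _ [m _ [/= fx gx]]]]; last first.
    rewrite /= (fgE x n).
    rewrite (le_lt_trans (ler_normD _ _))// (lt_le_trans (ltrD fx gx))//.
    by rewrite -rmorphD /= addrC subrK.
  move: fgr; rewrite norm_ltC => fgr.
  pose e := (r - Re `|(f + g) x - c|) / 2.
  have e0 : 0 < e by rewrite divr_gt0 ?subr_gt0.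
  have [m me] : exists m : nat, m.+1%:R^-1 < e.
    have [m _ H] := near_infty_natSinv_lt (PosNum e0).
    by exists m; by have := H m; apply => /=.
  have [|n fn] := dq (f x) m.+1%:R^-1; first by rewrite invr_gt0.
  exists n => //; exists m => //; split => //=.
  have -> : g x - (c - q n) = ((f + g) x - c) - (f x - q n).
    by rewrite (fgE x n) addrAC subrr add0r.
  rewrite (le_lt_trans (ler_normB _ _))//.
  rewrite -(cReK (normr_real ((f + g) x - c))).
  rewrite (@lt_le_trans _ _ ((Re `|(f + g) x - c|)%:C%C + (m.+1%:R^-1)%:C%C))//.
    by rewrite ltrD2l.
  by rewrite -rmorphD lecR; move: me; rewrite /e; set t := _^-1; lra.
apply: bigcupT_measurable => n; apply: bigcupT_measurable => m.
by apply: measurableI; exact: borel_ball.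
Qed.

Lemma borel_fun_cst (c : V) : borel_fun (fun=> c).
Proof. exact: measurable_cst. Qed.

Lemma borel_funZ (a : R[i]) f : borel_fun f -> borel_fun (a *: f).
Proof.
move=> mf; have [->|a0] := eqVneq a 0.
  by rewrite scale0r; exact: borel_fun_cst.
apply: ball_borel => c r.
have na : `|a| = (Re `|a|)%:C%C by rewrite cReK ?normr_real.
have a0' : 0 < Re `|a| by rewrite -ltcR -na normr_gt0.
rewrite (_ : mkset _ = [set x | `|f x - a^-1 *: c| < (r / Re `|a|)%:C%C]).
  exact: borel_ball.
apply/eq_set => x; congr is_true.
have -> : (a *: f) x - c = a *: (f x - a^-1 *: c).
  by rewrite scalerBr scalerA mulfV // scale1r.
rewrite normrZ na -(cReK (normr_real (f x - a^-1 *: c))) -rmorphM !ltcR.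
by rewrite ltr_pdivlMr // mulrC.
Qed.

Lemma measurable_sqnorm f : borel_fun f ->
  measurable_fun [set: X] (fun x => sqnorm (f x)).
Proof.
move=> mf; apply: (measurability _ (RGenInftyO.measurableE R)).
move=> _ [_ [r ->] <-]; rewrite setTI.
have [r0|r0] := ltP 0 r; last first.
  rewrite (_ : _ @^-1` _ = set0)//; apply/seteqP; split => // x /=.
  by rewrite in_itv /= ltNge (le_trans r0) ?sqnorm_ge0.
rewrite (_ : _ @^-1` _ = [set x | `|f x - 0| < (Num.sqrt r)%:C%C]).
  exact: borel_ball.
have H x : (sqnorm (f x) < r) = (Re `|f x| < Num.sqrt r).
  rewrite sqnormE -{1}(sqr_sqrtr (ltW r0)) ltr_sqr ?nnegrE ?sqrtr_ge0 //.
  by apply: ge0_cRe.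
by apply/seteqP; split => x /=; rewrite in_itv /= subr0 norm_ltC H.
Qed.

Lemma measurable_inner_Re f g : borel_fun f -> borel_fun g ->
  measurable_fun [set: X] (fun x => Re (inner (f x) (g x))).
Proof.
move=> mf mg; under eq_fun do rewrite inner_Re.
apply: measurable_funM => //; apply: measurable_funB.
  by apply: measurable_sqnorm; exact: borel_funD.
apply: measurable_sqnorm; apply: (@borel_funD f (- g)) => //.
by rewrite -scaleN1r; exact: borel_funZ.
Qed.

End borel.

Section L2fun.
Context d (X : measurableType d) (R : realType).
Variables (mu : {measure set X -> \bar R}) (V : separableHilbertType R).
Implicit Types f g : X -> V.

Definition sq_integrable f :=
  borel_fun f /\ (\int[mu]_x (sqnorm (f x))%:E < +oo)%E.

Definition L2pred : {pred X -> V} := [pred f | `[< sq_integrable f >]].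

Lemma L2predP f : reflect (sq_integrable f) (f \in L2pred).
Proof. exact: asboolP. Qed.

Lemma sqnorm_integrable f : sq_integrable f ->
  mu.-integrable [set: X] (fun x => (sqnorm (f x))%:E).
Proof.
move=> [mf foo]; apply/integrableP; split.
  by apply/measurable_EFinP; exact: measurable_sqnorm.
by under eq_integral do rewrite gee0_abs ?lee_fin ?sqnorm_ge0//.
Qed.

Lemma L2pred_submod_closed : submod_closed L2pred.
Proof.
split.
  apply/L2predP; split; first exact: borel_fun_cst.
  under eq_integral do rewrite /sqnorm linear0l /=.
  by rewrite integral0.
move=> a f g /L2predP L2f /L2predP L2g; apply/L2predP.
have [[mf _] [mg _]] := (L2f, L2g).
have mafg : borel_fun (a *: f + g) by apply: borel_funD => //; exact: borel_funZ.
split => //.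
have /integrableP[_] : mu.-integrable [set: X]
    (fun x => (sqnorm ((a *: f + g) x))%:E).
  apply: (@le_integrable _ _ _ mu _ measurableT _
    (fun x => (2 * (Re (`|a| ^+ 2) * sqnorm (f x) + sqnorm (g x)))%:E)).
  - by apply/measurable_EFinP; exact: measurable_sqnorm.
  - move=> x _; rewrite !abse_EFin lee_fin ger0_norm ?sqnorm_ge0 // ler_normr.
    apply/orP; left; rewrite -sqnormZ; exact: sqnormD_le.
  - rewrite (_ : (fun _ => _) = (fun x => 2%:E * ((Re (`|a| ^+ 2))%:E *
       (sqnorm (f x))%:E + (sqnorm (g x))%:E)))%E; last first.
      by [].
    apply: integrableZl => //; apply: integrableD => //.
      by apply: integrableZl => //; exact: sqnorm_integrable.
    exact: sqnorm_integrable.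
by under eq_integral do rewrite gee0_abs ?lee_fin ?sqnorm_ge0//.
Qed.

HB.instance Definition _ := GRing.isSubmodClosed.Build R[i] (X -> V) L2pred
  L2pred_submod_closed.

Definition L2fun := {f : X -> V | f \in L2pred}.
HB.instance Definition _ := [isSub of L2fun for @sval _ _].
HB.instance Definition _ := gen_eqMixin L2fun.
HB.instance Definition _ := gen_choiceMixin L2fun.
HB.instance Definition _ := [SubChoice_isSubLmodule of L2fun by <:].

Lemma L2funP (f : L2fun) : sq_integrable (val f).
Proof. exact/L2predP/(valP f). Qed.

Lemma L2funZE (a : R[i]) (f : L2fun) x : val (a *: f) x = a *: val f x.
Proof. by []. Qed.

Lemma L2funDE (f g : L2fun) x : val (f + g) x = val f x + val g x.
Proof. by []. Qed.

Definition null_fun (f : L2fun) : Prop := {ae mu, forall x, val f x = 0}.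

Definition null_pred : {pred L2fun} := [pred f | `[< null_fun f >]].

Lemma null_predP (f : L2fun) : reflect (null_fun f) (f \in null_pred).
Proof. exact: asboolP. Qed.

Lemma null_pred_submod_closed : submod_closed null_pred.
Proof.
split; first by apply/null_predP; exact: aeW.
move=> a f g /null_predP nf /null_predP ng; apply/null_predP.
apply: filterS2 nf ng => x /= fx gx.
change (a *: sval f x + sval g x = 0).
by rewrite fx gx scaler0 addr0.
Qed.

HB.instance Definition _ := GRing.isSubmodClosed.Build R[i] L2fun null_pred
  null_pred_submod_closed.

(* Square integrable functions up to equality almost everywhere (pi_L2P). *)
Definition L2 : Type := Quotient.quot (null_pred : zmodClosed L2fun).
HB.instance Definition _ := Choice.on L2.
HB.instance Definition _ := GRing.Zmodule.on L2.
HB.instance Definition _ := Quotient.on L2.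

Local Open Scope quotient_scope.

Lemma pi_L2P (f g : L2fun) :
  reflect ({ae mu, forall x, val f x = val g x}) (\pi_L2 f == \pi_L2 g).
Proof.
rewrite -Quotient.idealrBE; apply: (iffP (null_predP _)).
  apply: filterS => x h; apply/eqP; rewrite -subr_eq0; apply/eqP.
  exact: h.
apply: filterS => x h.
by change (val f x - val g x = 0); rewrite h subrr.
Qed.

Definition scaleL2 (a : R[i]) (u : L2) : L2 := \pi_L2 (a *: repr u).

Lemma pi_addL2 (f g : L2fun) : \pi_L2 (f + g) = \pi_L2 f + \pi_L2 g.
Proof. exact: Quotient.pi_add. Qed.

Lemma pi_scaleL2 a (f : L2fun) : \pi_L2 (a *: f) = scaleL2 a (\pi_L2 f).
Proof.
apply/eqP/pi_L2P; have /pi_L2P := eqxx (\pi_L2 f).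
have /eqP/pi_L2P : \pi_L2 (repr (\pi_L2 f)) = \pi_L2 f by rewrite reprK.
apply: filterS2 => x h _.
by rewrite !L2funZE h.
Qed.

Lemma scaleL2A a b (u : L2) : scaleL2 a (scaleL2 b u) = scaleL2 (a * b) u.
Proof.
elim/quotW: u => f.
by rewrite -(pi_scaleL2 b) -(pi_scaleL2 a) -pi_scaleL2 scalerA.
Qed.

Lemma scale1L2 : left_id 1 scaleL2.
Proof. by elim/quotW => f; rewrite -pi_scaleL2 scale1r. Qed.

Lemma scaleL2Dr : right_distributive scaleL2 +%R.
Proof.
move=> a; elim/quotW => f; elim/quotW => g.
by rewrite -(pi_addL2 f g) -!(pi_scaleL2 a) scalerDr pi_addL2.
Qed.

Lemma scaleL2Dl (u : L2) : {morph scaleL2^~ u : a b / a + b}.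
Proof.
elim/quotW: u => f a b.
by rewrite -(pi_scaleL2 a) -(pi_scaleL2 b) -(pi_scaleL2 (a + b)) scalerDl pi_addL2.
Qed.

HB.instance Definition _ := GRing.Zmodule_isLmodule.Build R[i] L2
  scaleL2A scale1L2 scaleL2Dr scaleL2Dl.

(* The class of f, or 0 if f is not square integrable. *)
Definition toL2 (f : X -> V) : L2 := \pi_L2 (insubd (0 : L2fun) f).

Definition fun_of_L2 (u : L2) : X -> V := val (repr u).

Definition dotL2 (u v : L2) : R[i] :=
  Complex (\int[mu]_x Re (inner (fun_of_L2 u x) (fun_of_L2 v x)))
          (\int[mu]_x Im (inner (fun_of_L2 u x) (fun_of_L2 v x))).

Lemma fun_of_L2P (u : L2) : sq_integrable (fun_of_L2 u).
Proof. exact: L2funP. Qed.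

Lemma inner_Re_integrable f g : sq_integrable f -> sq_integrable g ->
  mu.-integrable [set: X] (EFin \o (fun x => Re (inner (f x) (g x)))).
Proof.
move=> L2f L2g.
apply: (@le_integrable _ _ _ mu _ measurableT _
    (fun x => (sqnorm (f x) + sqnorm (g x))%:E)).
- by apply/measurable_EFinP; apply: measurable_inner_Re; [case: L2f|case: L2g].
- move=> x _; rewrite !abse_EFin lee_fin.
  by rewrite [leRHS]ger0_norm ?addr_ge0 ?sqnorm_ge0 // normr_inner_Re.
- rewrite (_ : (fun _ => _) = (fun x => (sqnorm (f x))%:E + (sqnorm (g x))%:E))%E//.
  by apply: integrableD => //; exact: sqnorm_integrable.
Qed.

Lemma inner_Im_integrable f g : sq_integrable f -> sq_integrable g ->
  mu.-integrable [set: X] (EFin \o (fun x => Im (inner (f x) (g x)))).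
Proof.
move=> L2f /L2predP L2g; under eq_fun do rewrite inner_Im.
apply: (@inner_Re_integrable f ('i%C *: g)) => //.
by apply/L2predP; exact: rpredZ.
Qed.

Lemma fun_of_L2_lin a (u v : L2) :
  {ae mu, forall x, fun_of_L2 (a *: u + v) x = a *: fun_of_L2 u x + fun_of_L2 v x}.
Proof.
have /eqP/pi_L2P : \pi_L2 (repr (a *: u + v)) = \pi_L2 (a *: repr u + repr v).
  by rewrite reprK pi_addL2 pi_scaleL2 !reprK.
by apply: filterS => x; apply.
Qed.

Lemma fun_of_toL2 f : sq_integrable f -> {ae mu, forall x, fun_of_L2 (toL2 f) x = f x}.
Proof.
move=> /L2predP L2f.
have /eqP/pi_L2P : \pi_L2 (repr (toL2 f)) = \pi_L2 (insubd (0 : L2fun) f).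
  by rewrite reprK.
by apply: filterS => x; rewrite insubdK.
Qed.

Lemma ae_eq_Rintegral (h k : X -> R) : 
  mu.-integrable [set: X] (EFin \o h) -> mu.-integrable [set: X] (EFin \o k) -> 
  {ae mu, forall x, h x = k x} ->
  \int[mu]_x h x = \int[mu]_x k x.
Proof.
move=> /integrableP[mh _] /integrableP[mk _] hk; congr fine.
by apply: ae_eq_integral => //; apply: filterS hk => x /= -> _.
Qed.

Lemma dotL2_linearl (w : L2) : linear_for *%R (dotL2 ^~ w).
Proof.
move=> a u v.
have Lu := fun_of_L2P u; have Lv := fun_of_L2P v; have Lw := fun_of_L2P w.
have IRu := inner_Re_integrable Lu Lw; have IIu := inner_Im_integrable Lu Lw.
have IRv := inner_Re_integrable Lv Lw; have IIv := inner_Im_integrable Lv Lw.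
have lin := fun_of_L2_lin a u v.
have Luv := fun_of_L2P (a *: u + v).
have IZ (r : R) (h : X -> R) : mu.-integrable [set: X] (EFin \o h) ->
    mu.-integrable [set: X] (EFin \o (fun x => r * h x)).
  by move=> ih; apply: (integrableZl measurableT r ih).
have IDD (h k : X -> R) : mu.-integrable [set: X] (EFin \o h) ->
    mu.-integrable [set: X] (EFin \o k) ->
    mu.-integrable [set: X] (EFin \o (fun x => h x + k x)).
  by move=> ih ik; apply: (integrableD measurableT ih ik).
apply/eqP; rewrite eq_complex; apply/andP; split; apply/eqP.
  rewrite cReD cReM /=.
  rewrite (@ae_eq_Rintegral _ (fun x =>
      Re a * Re (inner (fun_of_L2 u x) (fun_of_L2 w x)) +
      (- Im a) * Im (inner (fun_of_L2 u x) (fun_of_L2 w x)) +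
      Re (inner (fun_of_L2 v x) (fun_of_L2 w x)))).
  - rewrite RintegralD //; last by apply: (IDD) => //; exact: IZ.
    rewrite RintegralD //; [|exact: IZ|exact: IZ].
    by rewrite !RintegralZl // mulNr.
  - exact: inner_Re_integrable.
  - by apply: (IDD) => //; apply: (IDD); exact: IZ.
  - apply: filterS lin => x ->.
    by rewrite linearDl linearZl_LR /= cReD cReM mulNr.
rewrite cImD cImM /=.
rewrite (@ae_eq_Rintegral _ (fun x =>
    Re a * Im (inner (fun_of_L2 u x) (fun_of_L2 w x)) +
    Im a * Re (inner (fun_of_L2 u x) (fun_of_L2 w x)) +
    Im (inner (fun_of_L2 v x) (fun_of_L2 w x)))).
- rewrite RintegralD //; last by apply: (IDD) => //; exact: IZ.
  rewrite RintegralD //; [|exact: IZ|exact: IZ].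
  by rewrite !RintegralZl.
- exact: inner_Im_integrable.
- by apply: (IDD) => //; apply: (IDD); exact: IZ.
- apply: filterS lin => x ->.
  by rewrite linearDl linearZl_LR /= cImD cImM.
Qed.

Lemma inner_conj (v w : V) : inner v w = Num.conj (inner w v).
Proof. by rewrite hermC /= expr0 mul1r. Qed.

Lemma dotL2_conj (u v : L2) : dotL2 u v = (-1) ^+ false * Num.conj (dotL2 v u).
Proof.
rewrite expr0 mul1r; apply/eqP; rewrite eq_complex; apply/andP; split; apply/eqP.
  rewrite cReJ /=; congr fine; apply: eq_integral => x _.
  by rewrite inner_conj cReJ.
rewrite cImJ /= -mulN1r -RintegralZl //; last first.
  exact: inner_Im_integrable (fun_of_L2P _) (fun_of_L2P _).
congr fine; apply: eq_integral => x _.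
by rewrite inner_conj cImJ mulN1r.
Qed.

Lemma dotL2_linearr (w : L2) :
  linear_for (Num.conj \; *%R) (dotL2 w).
Proof.
move=> a u v; rewrite dotL2_conj expr0 mul1r.
rewrite [X in Num.conj X](dotL2_linearl w a u v) rmorphD rmorphM /=.
by rewrite (dotL2_conj w u) (dotL2_conj w v) !expr0 !mul1r.
Qed.

Lemma dotL2_gt0 (u : L2) : u != 0 -> 0 < dotL2 u u.
Proof.
move=> u0; have Lu := fun_of_L2P u.
have ReE : Re (dotL2 u u) = \int[mu]_x sqnorm (fun_of_L2 u x) by [].
have ImE : Im (dotL2 u u) = 0.
  rewrite /= (_ : (fun _ => _) = cst 0) ?Rintegral_cst ?mul0r//.
  apply/funext => x.
  have := cReK (ger0_real (dnorm_ge0 inner (fun_of_L2 u x))).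
  by move=> <-.
rewrite ltcE; apply/andP; split.
  by rewrite [X in X == _]ImE.
rewrite [ltRHS]ReE lt_neqAle; apply/andP; split; last first.
  by apply: Rintegral_ge0 => x _; exact: sqnorm_ge0.
apply: contra u0 => /eqP int0.
have ioo := sqnorm_integrable Lu.
have : (\int[mu]_x `|(sqnorm (fun_of_L2 u x))%:E| = 0)%E.
  under eq_integral do rewrite gee0_abs ?lee_fin ?sqnorm_ge0//.
  rewrite -(fineK (integrable_fin_num measurableT ioo)); congr EFin.
  exact: esym int0.
have /integrableP[mi _] := ioo.
move=> /(ae_eq_integral_abs mu measurableT mi) h.
have pi0 : \pi_L2 0 = 0 :> L2.
  by apply: (addrI (\pi_L2 0)); rewrite -pi_addL2 !addr0.
rewrite -[u]reprK -pi0; apply/pi_L2P.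
apply: filterS h => x /(_ I) [sq0]; apply/eqP.
by rewrite -sqnorm_eq0; apply/eqP.
Qed.

HB.instance Definition _ := bilinear_isBilinear.Build R[i] L2 L2 R[i] *%R
  (Num.conj \; *%R) dotL2 (dotL2_linearl, dotL2_linearr).
HB.instance Definition _ := isHermitianSesquilinear.Build R[i] L2 false
  (@Num.conj R[i]) dotL2 dotL2_conj.
HB.instance Definition _ := isDotProduct.Build R[i] L2 dotL2 dotL2_gt0.

Definition innerL2 : {dot L2 for (@Num.conj R[i])} := dotL2.

Definition mul_indic (Om : set X) (u : L2) : L2 :=
  toL2 (fun x => (\1_Om x : R[i]) *: fun_of_L2 u x).

Lemma sq_integrable_indic (Om : set X) f : measurable Om -> sq_integrable f ->
  sq_integrable (fun x => (\1_Om x : R[i]) *: f x).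
Proof.
move=> mO Lf; have [mf foo] := Lf.
set g := (fun x => _).
have gin x : x \in Om -> g x = f x by rewrite /g indicE => ->; rewrite scale1r.
have gout x : x \notin Om -> g x = 0.
  by rewrite /g indicE => /negbTE ->; rewrite scale0r.
have mg : borel_fun g.
  move=> _ Y mY.
  have mY1 := mf measurableT Y mY.
  have mY0 : measurable ((fun=> 0 : V) @^-1` Y : set X).
    rewrite -[X in measurable X]setTI.
    exact: (@borel_fun_cst _ X R V 0 measurableT Y mY).
  rewrite setTI in mY1.
  rewrite setTI (_ : _ @^-1` _ = (Om `&` f @^-1` Y) `|`
      (~` Om `&` (fun=> 0) @^-1` Y)); last first.
    apply/seteqP; split => x /=.
      have [xO|xO] := boolP (x \in Om).
        by rewrite gin // => Yx; left; split => //; exact: set_mem.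
      rewrite gout // => Yx; right; split => //.
      by move=> /mem_set; rewrite (negbTE xO).
    move=> [[/mem_set xO Yx]|[xO Yx]]; first by rewrite gin.
    by rewrite gout //; apply/negP => /set_mem.
  by apply: measurableU; apply: measurableI => //; exact: measurableC.
split => //.
apply: le_lt_trans foo; apply: ge0_le_integral => //.
- by move=> x _; rewrite lee_fin sqnorm_ge0.
- by apply/measurable_EFinP; exact: measurable_sqnorm.
- by apply/measurable_EFinP; exact: measurable_sqnorm.
- move=> x _; rewrite lee_fin.
  have [xO|xO] := boolP (x \in Om); first by rewrite gin.
  by rewrite gout // /sqnorm linear0l /= -/(sqnorm (f x)) sqnorm_ge0.
Qed.

Lemma mul_indicE (Om : set X) (u : L2) : measurable Om ->
  {ae mu, forall x, fun_of_L2 (mul_indic Om u) x = (\1_Om x : R[i]) *: fun_of_L2 u x}.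
Proof.
by move=> mO; apply: fun_of_toL2; apply: sq_integrable_indic => //; exact: fun_of_L2P.
Qed.

Definition supported_in (Om : set X) (u : L2) : Prop :=
  {ae mu, forall x, ~ Om x -> fun_of_L2 u x = 0}.

End L2fun.

Section operators.
Context (R : realType) (U : lmodType R[i]).
Variable ip : {dot U for (@Num.conj R[i])}.

Definition hnorm (u : U) : R := Num.sqrt (Re (ip u u)).

Definition norm_dense (D : set U) : Prop :=
  forall (u : U) (e : R), 0 < e -> exists2 v, D v & hnorm (u - v) < e.

Definition linear_subspace (L : set U) : Prop :=
  L 0 /\ forall (a : R[i]) (u v : U), L u -> L v -> L (a *: u + v).

Definition linear_span (B : set U) : set U :=
  [set u | exists (n : nat) (a : 'I_n -> R[i]) (v : 'I_n -> U),
     (forall i, B (v i)) /\ u = \sum_(i < n) a i *: v i].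

Definition lin_indep (n : nat) (v : 'I_n -> U) : Prop :=
  forall a : 'I_n -> R[i],
    \sum_(i < n) a i *: v i = 0 -> forall i, a i = 0.

(* All infinite dimensions are identified with +oo. *)
Definition hdim (L : set U) : \bar R :=
  ereal_sup [set (n%:R : R)%:E | n in
    [set n | exists v : 'I_n -> U, (forall i, L (v i)) /\ lin_indep v]].

Definition orthonormal_basis (B : set U) : Prop :=
  (forall u v : U, B u -> B v -> ip u v = (u == v)%:R) /\
  norm_dense (linear_span B).

(* The usual trace of a nonnegative operator, computed in the orthonormal
   basis B, on which it does not depend. *)
Definition op_trace (B : set U) (T : U -> U) : \bar R :=
  \esum_(e in B) (Re (ip (T e) e))%:E.

(* A possibly unbounded operator; its values outside dom are irrelevant. *)
Record unbounded_op := UnboundedOp {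
  dom : set U ;
  op_fun :> U -> U ;
  dom_subspace : linear_subspace dom ;
  op_linear : forall (a : R[i]) (u v : U), dom u -> dom v ->
    op_fun (a *: u + v) = a *: op_fun u + op_fun v
}.

(* The pairs (u, w) such that u is in the domain of the adjoint of A and w is
   the value of the adjoint at u. *)
Definition adjoint_graph (A : unbounded_op) (u w : U) : Prop :=
  forall v, dom A v -> ip (A v) u = ip v w.

Definition self_adjoint (A : unbounded_op) : Prop :=
  norm_dense (dom A) /\
  forall u w, adjoint_graph A u w <-> (dom A u /\ A u = w).

Definition nonneg_op (A : unbounded_op) : Prop :=
  forall u, dom A u -> 0 <= ip (A u) u.

(* The zero operator is nonnegative and has E(]-oo, 0[) = 0, while its Dirichlet
   distribution function at 0 is the dimension of L2(Om, V): bounds through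
   E(]-oo, 2 lambda[) at lambda = 0 need strict positivity. *)
Definition posdef_op (A : unbounded_op) : Prop :=
  forall u, dom A u -> u != 0 -> 0 < ip (A u) u.

Definition orthogonal_projection (P : U -> U) : Prop :=
  [/\ linear P, forall u, P (P u) = P u & forall u v, ip (P u) v = ip u (P v)].

Record projection_valued_measure := PVM {
  pvm :> set (measurableTypeR R) -> U -> U ;
  pvm_proj : forall S, measurable S -> orthogonal_projection (pvm S) ;
  pvm0 : forall u, pvm set0 u = 0 ;
  pvmT : forall u, pvm setT u = u ;
  pvmI : forall S T, measurable S -> measurable T ->
    forall u, pvm (S `&` T) u = pvm S (pvm T u) ;
  pvm_sigma_additive : forall u,
    semi_sigma_additive (fun S => (Re (ip (pvm S u) (pvm S u)))%:E)
}.

(* The scalar measure S |-> <E(S) u, u> = |E(S) u|^2; the second form is used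
   because it is nonnegative even on nonmeasurable S. *)
Definition scalar_measure (E : projection_valued_measure) (u : U)
    (S : set (measurableTypeR R)) : \bar R :=
  (Re (ip (E S u) (E S u)))%:E.

Lemma scalar_measure0 (E : projection_valued_measure) (u : U) :
  scalar_measure E u set0 = 0%E.
Proof. by rewrite /scalar_measure pvm0 linear0l. Qed.

Lemma scalar_measure_ge0 (E : projection_valued_measure) (u : U) S :
  (0 <= scalar_measure E u S)%E.
Proof. by rewrite lee_fin; apply/ge0_cRe/dnorm_ge0. Qed.

HB.instance Definition _ (E : projection_valued_measure) (u : U) :=
  isMeasure.Build _ _ _ (scalar_measure E u)
    (scalar_measure0 E u) (scalar_measure_ge0 E u)
    (@pvm_sigma_additive E u).

Lemma scalar_measureE (E : projection_valued_measure) (u : U) S :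
  measurable S -> scalar_measure E u S = (Re (ip (E S u) u))%:E.
Proof.
move=> mS; have [_ idem sym] := pvm_proj E mS.
by rewrite /scalar_measure -sym idem.
Qed.

(* E is the spectral measure of A, i.e. A is the integral of t dE(t).  The
   diagonal terms determine A by polarization. *)
Definition spectral_measure_of (A : unbounded_op)
    (E : projection_valued_measure) : Prop :=
  (forall u, dom A u <-> (\int[scalar_measure E u]_t (t ^+ 2)%:E < +oo)%E) /\
  (forall u, dom A u -> ip (A u) u = (\int[scalar_measure E u]_t t)%:C%C).

(* The form domain dom(|A|^(1/2)) and the quadratic form of A. *)
Definition form_dom (E : projection_valued_measure) (u : U) : Prop :=
  (scalar_measure E u).-integrable setT (fun t => t%:E).

Definition energy (E : projection_valued_measure) (u : U) : R :=
  \int[scalar_measure E u]_t t.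

End operators.

Section increasing.
Context (R : realType).

Definition upper_inverse (phi : R -> \bar R) (y : R) : \bar R :=
  ereal_sup [set x%:E | x in [set x : R | (phi x <= y%:E)%E]].

Definition primitive_inverse (F : R -> \bar R) (y : R) : \bar R :=
  (\int[lebesgue_measure]_(u in `[0%R, y]) upper_inverse F u)%E.

(* The value at -oo is irrelevant: it is applied to nonnegative y. *)
Definition primitive_inverse_ext (F : R -> \bar R) (y : \bar R) : \bar R :=
  match y with
  | y%:E => primitive_inverse F y
  | +oo%E => lim (primitive_inverse F y @[y --> +oo])
  | -oo%E => 0%E
  end.

End increasing.

Section dirichlet.
Context d (X : measurableType d) (R : realType).
Variables (mu : {measure set X -> \bar R}) (V : separableHilbertType R).
Local Notation ip := (innerL2 mu V).
Local Notation pvm := (projection_valued_measure ip).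

(* F_Om(lambda), with B the orthonormal basis in which the trace is computed. *)
Definition spectral_distribution (E : pvm) (B : set (L2 mu V)) (Om : set X)
    (lambda : R) : \bar R :=
  let Pi := E `]-oo, lambda[%classic in
  op_trace ip B (fun u => Pi (mul_indic Om (Pi u))).

Definition dirichlet_distribution (E : pvm) (Om : set X) (lambda : R) : \bar R :=
  ereal_sup [set hdim L | L in [set L : set (L2 mu V) |
    [/\ linear_subspace L,
        forall u, L u -> supported_in Om u &
        forall u, L u ->
          form_dom E u /\ energy E u <= lambda * hnorm ip u ^+ 2]]].

End dirichlet.

(* Main.v *)
(** Let f_1, ..., f_n be an orthonormal family supported in Om whose energies
    are at most lambda.  The sum nu of its scalar spectral measures has mass n
    and first moment at most lambda n.  Since <f_i, w> = <f_i, chi_Om w>,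
    Parseval's inequality in the basis B and Bessel's inequality for the f_i
    give nu(]-oo, t[) <= F(t), which replaces the cyclicity of the trace.
    Hence F^{-1} is at most the quantile function of nu, which pushes Lebesgue
    measure on ]0, n[ forward to nu, so that the integral of F^{-1} over
    [0, n] is at most the first moment of nu.  If A is nonnegative, nu lives on
    [0, +oo[ and Markov's inequality yields nu([2 lambda, +oo[) <= n / 2. *)

Require Import Defs.
From HB Require Import structures.
From mathcomp Require Import all_boot all_order all_algebra.
From mathcomp Require Import all_classical all_reals all_analysis.
From mathcomp Require Import measurable_realfun.
From mathcomp Require Import complex.
From mathcomp Require Import lra.

Set Implicit Arguments.
Unset Strict Implicit.
Unset Printing Implicit Defensive.

Import Order.TTheory GRing.Theory Num.Theory numFieldNormedType.Exports.

Local Open Scope classical_set_scope.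
Local Open Scope ring_scope.

Local Notation Re := (@complex.Re _).

(** * Bessel, Gram-Schmidt and Parseval for orthonormal families *)

Section orthonormal_families.
Context (R : realType) (U : lmodType R[i]) (ip : {dot U for (@Num.conj R[i])}).

Definition orthonormal_on (I : eqType) (r : seq I) (f : I -> U) : Prop :=
  {in r &, forall i j, ip (f i) (f j) = (i == j)%:R}.

Lemma dot_conj (u v : U) : ip u v = Num.conj (ip v u).
Proof. by rewrite hermC /= expr0 mul1r. Qed.

(** For an orthonormal family this is the component of [u] orthogonal to its span. *)
Definition ortho_rest (I : eqType) (r : seq I) (f : I -> U) (u : U) : U :=
  u - \sum_(i <- r) ip u (f i) *: f i.

Section family.
Context (I : eqType) (r : seq I) (f : I -> U).
Hypotheses (ur : uniq r) (orf : orthonormal_on r f).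

Lemma ortho_restP u j : j \in r -> ip (ortho_rest r f u) (f j) = 0.
Proof.
move=> jr; rewrite linearBl linear_sumlz (bigD1_seq j) //= big_seq_cond big1.
  by rewrite linearZl_LR /= orf// eqxx mulr1 addr0 subrr.
move=> i /andP[ir ij].
by rewrite linearZl_LR /= orf// (negbTE ij) mulr0.
Qed.

Lemma ortho_restE u : ip (ortho_rest r f u) (ortho_rest r f u) =
  ip u u - \sum_(i <- r) `|ip u (f i)| ^+ 2.
Proof.
rewrite {2}/ortho_rest linearBr linear_sumr big_seq big1 ?subr0; last first.
  by move=> i ir; rewrite linearZr_LR /= ortho_restP// mulr0.
rewrite linearBl linear_sumlz; congr (_ - _); apply: eq_bigr => i _.
by rewrite linearZl_LR /= normCK (dot_conj (f i) u).
Qed.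

Lemma bessel u : \sum_(i <- r) `|ip u (f i)| ^+ 2 <= ip u u.
Proof. by rewrite -subr_ge0 -ortho_restE dnorm_ge0. Qed.

End family.

Lemma cRe_sum (I : Type) (r : seq I) (P : pred I) (z : I -> R[i]) :
  Re (\sum_(i <- r | P i) z i) = \sum_(i <- r | P i) Re (z i).
Proof. by apply: (big_morph _ (@cReD R)). Qed.

Lemma hnorm_sqr u : hnorm ip u ^+ 2 = Re (ip u u).
Proof. by rewrite sqr_sqrtr// ge0_cRe// dnorm_ge0. Qed.

Lemma sum_scale_comb n k (c : 'I_n -> R[i]) (M : 'I_n -> 'I_k -> R[i])
    (f : 'I_k -> U) :
  \sum_(i < n) c i *: (\sum_(j < k) M i j *: f j) =
  \sum_(j < k) (\sum_(i < n) c i * M i j) *: f j.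
Proof.
under eq_bigr do rewrite scaler_sumr.
rewrite exchange_big /=; apply: eq_bigr => j _.
by rewrite scaler_suml; apply: eq_bigr => i _; rewrite scalerA.
Qed.

(** The rank is at most [k < n], so the left kernel is nonzero. This serves to show that [n]
    independent vectors cannot all lie in the span of [k] vectors. *)
Lemma left_kernel n k (M : 'I_n -> 'I_k -> R[i]) : (k < n)%N ->
  exists c : 'I_n -> R[i], (exists i, c i != 0) /\
    forall j, \sum_(i < n) c i * M i j = 0.
Proof.
move=> kn; pose A := \matrix_(i < n, j < k) M i j.
have kA : kermx A != 0.
  by rewrite kermx_eq0 -row_leq_rank -ltnNge (leq_ltn_trans (rank_leq_col _)).
have /rowV0Pn[v /sub_kermxP vA v0] := kA.
exists (v 0); split.
  by move: v0 => /rV0Pn.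
move=> j; have /matrixP/(_ 0 j) := vA; rewrite !mxE => vAj.
by rewrite -[RHS]vAj; apply: eq_bigr => i _; rewrite mxE.
Qed.

Lemma linear_subspace_sum (L : set U) (I : Type) (r : seq I) (c : I -> R[i])
    (f : I -> U) :
  linear_subspace L -> (forall i, L (f i)) -> L (\sum_(i <- r) c i *: f i).
Proof.
move=> [L0 LP] Lf; elim: r => [|i r IH]; first by rewrite big_nil.
by rewrite big_cons; apply: LP.
Qed.

(** An orthonormal family of size [k < n] is extended by the normalized remainder of some [v i]. The
    values of [f] stay in [L] at all indices, so that properties of [L] later hold for every
    index. *)
Lemma gram_schmidt (L : set U) n (v : 'I_n -> U) : linear_subspace L ->
  (forall i, L (v i)) -> lin_indep v -> forall k, (k <= n)%N ->
  exists2 f : nat -> U, (forall i, L (f i)) & orthonormal_on (index_iota 0 k) f.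
Proof.
move=> sL Lv iv; elim=> [_|k IH kn].
  by exists (fun=> 0) => [i|i j]; [exact: sL.1|rewrite in_nil].
have [f Lf orf] := IH (ltnW kn).
have [i wi0] : exists i, ortho_rest (index_iota 0 k) f (v i) != 0.
  (* If every remainder vanished, each [v i] would be a combination of the [k] vectors [f j], and
     [left_kernel] would give a nontrivial relation among the [v i]. *)
  apply: contrapT => /forallNP H.
  have vE i : v i = \sum_(j < k) ip (v i) (f j) *: f j.
    have := H i; move=> /negP; rewrite negbK subr_eq0 => /eqP.
    by rewrite big_mkord.
  have [c [[i ci0] cM]] := left_kernel (fun i (j : 'I_k) => ip (v i) (f j)) kn.
  move: ci0; rewrite (iv c) ?eqxx//.
  under eq_bigr do rewrite vE.
  rewrite (sum_scale_comb c (fun i j => ip (v i) (f j)) (fun j : 'I_k => f j)).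
  by rewrite big1// => j _; rewrite cM scale0r.
set w := ortho_rest _ _ _ in wi0.
have Lw : L w.
  rewrite /w /ortho_rest addrC -scaleN1r; apply: sL.2 => //.
  exact: linear_subspace_sum.
have wf j : (j < k)%N -> ip w (f j) = 0.
  by move=> jk; apply: ortho_restP; rewrite ?iota_uniq// mem_index_iota.
have fw j : (j < k)%N -> ip (f j) w = 0 by move=> jk; rewrite dot_conj wf// conjC0.
pose a : R[i] := (sqrtC (ip w w))^-1.
have a0 : 0 <= a by rewrite invr_ge0 sqrtC_ge0 dnorm_ge0.
have aw : ip (a *: w) (a *: w) = 1.
  rewrite linearZl_LR linearZr_LR /= (geC0_conj a0) mulrA /a -expr2 exprVn sqrtCK.
  by rewrite mulVf// dnorm_eq0.
exists (fun j => if (j < k)%N then f j else a *: w) => [j|j l].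
  case: ifP => // _.
  by rewrite -[_ *: _]addr0; apply: sL.2 => //; exact: sL.1.
rewrite !mem_index_iota !ltnS /= => jk lk.
have [jk'|kj] := ltnP j k; have [lk'|kl] := ltnP l k.
- by rewrite orf// mem_index_iota.
- by rewrite linearZr_LR /= fw// mulr0 ltn_eqF// (leq_trans jk').
- by rewrite linearZl_LR /= wf// mulr0 gtn_eqF// (leq_trans lk').
- have -> : j = l by apply/eqP; rewrite eqn_leq (leq_trans jk kl) (leq_trans lk kj).
  by rewrite eqxx.
Qed.

(** Density gives a finite combination [y] of basis vectors close to [u]. The remainders of [u] and
    [u - y] along these vectors coincide, so the finite Bessel sum misses |u|^2 by at most |u -
    y|^2. *)
Lemma parseval_le (B : set U) (u : U) : orthonormal_basis ip B ->
  ((Re (ip u u))%:E <= \esum_(e in B) (Re (`|ip u e| ^+ 2))%:E)%E.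
Proof.
move=> [oB dB]; apply/lee_addgt0Pr => e e0.
have se0 : 0 < Num.sqrt e by rewrite sqrtr_gt0.
have [_ [n [a [v [Bv ->]]]]] := dB u _ se0.
set y := \sum_(i < n) _ => uy.
(* Basis vectors may repeat among the [v i], while the remainder identities require a duplicate-free
   list. *)
pose s := undup [seq v i | i <- index_enum 'I_n].
have Bs w : w \in s -> B w.
  by rewrite mem_undup => /mapP[i _ ->].
have us : uniq s by exact: undup_uniq.
have os : orthonormal_on s id.
  by move=> x z xs zs; apply: oB; exact: Bs.
have restP (k x z : U) c : ortho_rest s id (c *: x + z) =
    c *: ortho_rest s id x + ortho_rest s id z.
  rewrite /ortho_rest scalerBr addrACA -opprD; congr (_ - _).
  rewrite scaler_sumr -big_split /=; apply: eq_bigr => i _.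
  by rewrite linearDl linearZl_LR /= scalerDl scalerA.
have rest0 : ortho_rest s id 0 = 0.
  rewrite /ortho_rest big1 ?subr0// => i _.
  by rewrite linear0l scale0r.
have restv i : ortho_rest s id (v i) = 0.
  have vs : v i \in s by rewrite mem_undup; apply: map_f; rewrite mem_index_enum.
  rewrite /ortho_rest (bigD1_seq (v i))//= os// eqxx scale1r big_seq_cond big1.
    by rewrite addr0 subrr.
  by move=> w /andP[ws wv]; rewrite os// eq_sym (negbTE wv) scale0r.
have resty : ortho_rest s id y = 0.
  rewrite /y; elim: (index_enum _) => [|i r IH]; first by rewrite big_nil.
  by rewrite big_cons restP// restv IH scaler0 addr0.
have rE : ortho_rest s id u = ortho_rest s id (u - y).
  by rewrite -scaleN1r addrC restP// resty scaler0 add0r.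
have key : Re (ip u u) <= \sum_(w <- s) Re (`|ip u w| ^+ 2) + e.
  rewrite -cRe_sum addrC -lerBlDr -cReN -cReD -(ortho_restE us os) rE.
  rewrite (ortho_restE us os) cReD cReN lerBlDr (@le_trans _ _ e)//.
    rewrite -hnorm_sqr -(sqr_sqrtr (ltW e0)) ler_sqr ?nnegrE ?sqrtr_ge0//.
    exact: ltW.
  rewrite lerDl cRe_sum sumr_ge0// => w _.
  by rewrite ge0_cRe// exprn_ge0.
apply: (@le_trans _ _ (\sum_(w <- s) (Re (`|ip u w| ^+ 2))%:E + e%:E)%E).
  by rewrite sumEFin -EFinD lee_fin.
rewrite leeD2r//; apply: esum_ge; exists [set` s].
  by split; [exact: finite_seq|move=> w /Bs].
by rewrite -fsbig_seq.
Qed.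

End orthonormal_families.

(** * Restricted measures and generalized inverses *)

Lemma ge0_integral_mrestr d (T : measurableType d) (R : realType)
    (mu : {measure set T -> \bar R}) (D : set T) (mD : measurable D)
    (g : T -> \bar R) : measurable_fun setT g -> (forall x, (0 <= g x)%E) ->
  (\int[mrestr mu mD]_x g x = \int[mu]_(x in D) g x)%E.
Proof.
move=> mg g0; rewrite -(setUv D) ge0_integral_setU//; last 3 first.
- exact: measurableC.
- by rewrite setUv.
- by rewrite disj_set2E; apply/eqP; exact: setICr.
rewrite (@eq_measure_integral _ _ _ (~` D) mzero); last first.
  move=> A mA AD; rewrite /= /mrestr (_ : A `&` D = set0) ?measure0//.
  by rewrite -subset0 => x [/AD].
rewrite integral_measure_zero adde0; apply: eq_measure_integral => A mA AD.
by rewrite /= /mrestr setIidl.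
Qed.

Section upper_inverse.
Context (R : realType).
Implicit Types (F G : R -> \bar R) (x u : R).

Lemma upper_inverse_ge F x u : (F x <= u%:E)%E -> (x%:E <= upper_inverse F u)%E.
Proof. by move=> Fx; apply: ereal_sup_ubound; exists x. Qed.

Lemma upper_inverse_nd F : {homo upper_inverse F : u v / u <= v >-> (u <= v)%E}.
Proof.
move=> u v uv; apply: le_ereal_sup => _ [x /= Fx <-]; exists x => //=.
by rewrite (le_trans Fx)// lee_fin.
Qed.

Lemma upper_inverse_anti F G u : (forall x, (G x <= F x)%E) ->
  (upper_inverse F u <= upper_inverse G u)%E.
Proof.
move=> GF; apply: le_ereal_sup => _ [x /= Fx <-]; exists x => //=.
exact: le_trans (GF x) Fx.
Qed.

(** Preimages of closed up-rays under a monotone map are order-convex, hence intervals. *)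
Lemma emeasurable_nondecreasing (h : R -> \bar R) :
  {homo h : u v / u <= v >-> (u <= v)%E} -> measurable_fun setT h.
Proof.
move=> nd; apply: (measurability _ (ErealGenCInfty.measurableE R)).
move=> _ [_ [r ->] <-]; rewrite setTI; apply: is_interval_measurable.
move=> x y /=; rewrite !in_itv /= !andbT => hx hy z /andP[xz _] /=.
by rewrite in_itv /= andbT (le_trans hx)// nd.
Qed.

Lemma measurable_upper_inverse F : measurable_fun setT (upper_inverse F).
Proof. by apply: emeasurable_nondecreasing => x y; exact: upper_inverse_nd. Qed.

(** The endpoints are Lebesgue null. They are dropped because a quantile function may be infinite at
    [0] and [m]. *)
Lemma ge0_integral_itv_cc_oo (m : R) (h : R -> \bar R) : 0 <= m ->
  measurable_fun setT h ->
  (\int[lebesgue_measure]_(u in `[0%R, m]) h u =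
   \int[lebesgue_measure]_(u in `]0%R, m[) h u)%E.
Proof.
move=> m0 mh; rewrite -integral_itv_obnd_cbnd; last exact: measurable_funTS.
by rewrite -integral_itv_bndo_bndc//; exact: measurable_funTS.
Qed.

End upper_inverse.

(** * Quantile transform of a finite measure on the line *)

Section quantile.
Context (R : realType) (nu : {measure set (measurableTypeR R) -> \bar R}) (m : R).
Hypothesis nuT : nu setT = m%:E.

Let G (x : R) : \bar R := nu `]-oo, x[%classic.

Let Gle x : (G x <= m%:E)%E.
Proof. by rewrite -nuT le_measure ?inE. Qed.

Let Gge0 x : (0 <= G x)%E. Proof. exact: measure_ge0. Qed.

Let Gfin x : (fine (G x))%:E = G x.
Proof. by rewrite fineK// ge0_fin_numE// (le_lt_trans (Gle x))// ltry. Qed.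

Let m0 : 0 <= m. Proof. by rewrite -lee_fin -nuT. Qed.

Let Gnd x y : x <= y -> (G x <= G y)%E.
Proof.
move=> xy; rewrite le_measure ?inE//.
by apply: subset_itvl; rewrite bnd_simp.
Qed.

(* The distribution function of nu is left continuous, so the supremum defining
   its inverse behaves like a maximum. *)
Lemma upper_inverse_geP x (u : R) :
  (x%:E <= upper_inverse G u)%E = (G x <= u%:E)%E.
Proof.
apply/idP/idP; last exact: upper_inverse_ge.
move=> xu.
have Gk k : (G (x - k.+1%:R^-1) <= u%:E)%E.
  have : ((x - k.+1%:R^-1)%:E < upper_inverse G u)%E.
    by rewrite (lt_le_trans _ xu)// lte_fin ltrBlDr ltrDl invr_gt0.
  move=> /ereal_sup_gt[_ [y /= Gy <-]]; rewrite lte_fin => xy.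
  by rewrite (le_trans _ Gy)// Gnd// ltW.
pose S k : set (measurableTypeR R) := `]-oo, (x - k.+1%:R^-1)[%classic.
have UE : \bigcup_k S k = `]-oo, x[%classic.
  apply/seteqP; split => [y [k _]|y]; rewrite /S /= !in_itv /=.
    by move=> /lt_trans; apply; rewrite ltrBlDr ltrDl invr_gt0.
  move=> yx; have xy0 : 0 < x - y by rewrite subr_gt0.
  have [k _ H] := near_infty_natSinv_lt (PosNum xy0).
  exists k => //=; rewrite in_itv /=.
  by have /= := H k (leqnn k); rewrite ltrBrDl -ltrBrDr.
have cvG : nu (S k) @[k --> \oo] --> G x.
  rewrite /G -UE; apply: nondecreasing_cvg_mu.
  - by move=> k; exact: measurable_itv.
  - by rewrite UE; exact: measurable_itv.
  move=> i j ij; apply/subsetPset/subset_itvl; rewrite bnd_simp.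
  by rewrite lerD2l lerN2 lef_pV2 ?posrE// ler_nat ltnS.
rewrite -(cvg_lim _ cvG)//; apply: lime_le; first by apply/cvg_ex; exists (G x).
by apply: nearW => k; exact: Gk.
Qed.

(** [G] tends to [0] at -oo, so [0 < u] excludes the value -oo; it tends to [m] at +oo, so [u < m]
    excludes the value +oo. *)
Lemma upper_inverse_fin_num (u : R) : 0 < u < m ->
  upper_inverse G u \is a fin_num.
Proof.
move=> /andP[u0 um].
have bd (y : R) : exists k : nat, - k%:R <= y <= k%:R.
  exists (Num.bound `|y|); rewrite -ler_norml ltW//.
  exact: archi_boundP.
rewrite fin_numE; apply/andP; split.
  pose S k : set (measurableTypeR R) := `]-oo, (- k%:R)[%classic.
  have IE : \bigcap_k S k = set0.
    rewrite -subset0 => y Sy; have [k /andP[yk _]] := bd y.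
    by have := Sy k I; rewrite /S /= in_itv /= ltNge yk.
  have cvG : nu (S k) @[k --> \oo] --> 0%E.
    rewrite -(@measure0 _ _ _ nu) -IE; apply: nonincreasing_cvg_mu.
    - by rewrite (le_lt_trans (Gle _))// ltry.
    - by move=> k; exact: measurable_itv.
    - by rewrite IE.
    - move=> i j ij; apply/subsetPset/subset_itvl; rewrite bnd_simp.
      by rewrite lerN2 ler_nat.
  apply/eqP => uN.
  have : (u%:E <= 0)%E.
    rewrite -(cvg_lim _ cvG)//; apply: lime_ge; first by apply/cvg_ex; exists 0%E.
    apply: nearW => k; rewrite leNgt; apply/negP => /ltW.
    by move=> /(@upper_inverse_ge _ G); rewrite uN.
  by rewrite lee_fin leNgt u0.
pose S k : set (measurableTypeR R) := `]-oo, k%:R[%classic.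
have UE : \bigcup_k S k = setT.
  rewrite -subTset => y _; have [k /andP[_ yk]] := bd y.
  exists k.+1 => //; rewrite /S /= in_itv /= (le_lt_trans yk)//.
  by rewrite ltr_nat.
have cvG : nu (S k) @[k --> \oo] --> m%:E.
  rewrite -nuT -UE; apply: nondecreasing_cvg_mu.
  - by move=> k; exact: measurable_itv.
  - by rewrite UE.
  move=> i j ij; apply/subsetPset/subset_itvl; rewrite bnd_simp.
  by rewrite ler_nat.
apply/eqP => uN.
have : (m%:E <= u%:E)%E.
  rewrite -(cvg_lim _ cvG)//; apply: lime_le; first by apply/cvg_ex; exists m%:E.
  by apply: nearW => k; rewrite -[nu _]/(G k%:R) -upper_inverse_geP uN leey.
by rewrite lee_fin leNgt um.
Qed.

(** The quantile function of [nu]. The inverse is finite on []0, m[], so [fine] can replace an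
    infinite value by [0] only outside that interval. *)
Let q (u : R) : R := fine (upper_inverse G u).

Let mq : measurable_fun setT q.
Proof.
apply: measurableT_comp; last exact: measurable_upper_inverse.
exact: fine_measurable.
Qed.

Let moo : measurable (`]0, m[%classic : set R). Proof. exact: measurable_itv. Qed.

Let mq' : measurable_fun setT (q : R -> measurableTypeR R) := mq.

Let nuq : {measure set (measurableTypeR R) -> \bar R}.
Proof.
refine (pushforward (mrestr lebesgue_measure moo) (q : R -> measurableTypeR R)).
exact: mq'.
Defined.

(** The rays []-oo, x[] are stable under intersection, generate the Borel sets and have finite mass,
    so it suffices to compare both measures on them. By [upper_inverse_geP], for [u] in []0, m[] one
    has [q u < x] iff [u < G x], and []0, G x[] has length [G x]. *)
Lemma pushforward_quantile (A : set (measurableTypeR R)) : measurable A ->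
  nu A = nuq A.
Proof.
pose g k : set (measurableTypeR R) := `]-oo, k%:R[%classic.
apply: (@measure_unique _ R (measurableTypeR R) (@RGenInftyO.G R) g
  (RGenInftyO.measurableE R) _ _ _ nu nuq) => //.
- move=> _ _ [x ->] [y ->]; exists (Num.min x y).
  by apply/seteqP; split => z /=; rewrite !in_itv /= lt_min;
    [move=> [-> ->]|move=> /andP].
- by move=> i; exists i%:R.
- rewrite -subTset => y _; exists (Num.bound `|y|) => //.
  by rewrite /g /= in_itv /= (le_lt_trans (ler_norm _))// archi_boundP.
- move=> _ [x ->]; rewrite /= /pushforward /mrestr -/(G x).
  rewrite (_ : _ `&` _ = `]0, fine (G x)[%classic).
    rewrite lebesgue_measure_itv /= lte_fin oppr0 adde0 Gfin.
    by case: ltP => // Gx0; apply/eqP; rewrite eq_le Gge0 andbT -Gfin lee_fin.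
  apply/seteqP; split => u /=; rewrite !in_itv /=.
    move=> [+ um]; rewrite /q -lte_fin fineK ?upper_inverse_fin_num//.
    rewrite ltNge upper_inverse_geP -ltNge -[X in _ && X]lte_fin Gfin => ->.
    by case/andP: um => ->.
  move=> /andP[u0]; rewrite -lte_fin Gfin => uG.
  have um : 0 < u < m by rewrite u0 -lte_fin (lt_le_trans uG).
  split => //; rewrite /q -lte_fin fineK ?upper_inverse_fin_num//.
  by rewrite ltNge upper_inverse_geP -ltNge.
- by move=> k; rewrite (le_lt_trans (Gle _))// ltry.
Qed.

Lemma ge0_integral_quantile (g : R -> \bar R) :
  measurable_fun setT g -> (forall x, (0 <= g x)%E) ->
  (\int[nu]_t g t = \int[lebesgue_measure]_(u in `]0%R, m[) g (q u))%E.
Proof.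
move=> mg g0.
rewrite (eq_measure_integral (nuq)); last first.
  by move=> A mA _; exact: pushforward_quantile.
rewrite ge0_integral_pushforward// preimage_setT ge0_integral_mrestr//.
- exact: measurableT_comp.
- by move=> x; exact: g0.
Qed.

(** [G <= F] reverses to [upper_inverse F <= q] on []0, m[]. Positive and negative parts are
    compared separately, which also covers infinite integrals. *)
Lemma integral_upper_inverse_le (F : R -> \bar R) :
  (forall x, (nu `]-oo, x[%classic <= F x)%E) ->
  (primitive_inverse F m <= \int[nu]_t t%:E)%E.
Proof.
move=> GF; rewrite /primitive_inverse integralE [leRHS]integralE.
have mF := measurable_upper_inverse F.
have Fq u : 0 < u < m -> (upper_inverse F u <= (q u)%:E)%E.
  by move=> um; rewrite fineK ?upper_inverse_fin_num// upper_inverse_anti.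
have mE : measurable_fun [set: measurableTypeR R] (EFin : _ -> \bar R).
  exact: EFin_measurable.
have mFp := measurable_funepos mF; have mFn := measurable_funeneg mF.
have mEp := measurable_funepos mE; have mEn := measurable_funeneg mE.
rewrite !ge0_integral_itv_cc_oo// !ge0_integral_quantile//.
apply: leeB; apply: ge0_le_integral => //.
- exact: measurable_funTS.
- by apply: measurable_funTS; exact: (measurableT_comp mEp mq).
- move=> u; rewrite /= in_itv /= => um.
  by rewrite !funeposE ge_max !le_max Fq//= lexx orbT.
- by apply: measurable_funTS; exact: (measurableT_comp mEn mq).
- exact: measurable_funTS.
- move=> u; rewrite /= in_itv /= => um.
  by rewrite !funenegE ge_max !le_max leeN2 Fq//= lexx orbT.
Qed.

End quantile.

(** * Limit of the primitive at +oo *)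

Section primitive_at_infinity.
Context (R : realType) (F : R -> \bar R).

Let h := upper_inverse F.
Let P (y : R) : \bar R := (\int[lebesgue_measure]_(u in `[0%R, y]) (h^\+ u))%E.
Let M (y : R) : \bar R := (\int[lebesgue_measure]_(u in `[0%R, y]) (h^\- u))%E.

Let mh : measurable_fun setT h := measurable_upper_inverse F.
Let mhp : measurable_fun setT (h^\+)%E. Proof. exact: measurable_funepos. Qed.
Let mhn : measurable_fun setT (h^\-)%E. Proof. exact: measurable_funeneg. Qed.

Let phiE y : primitive_inverse F y = (P y - M y)%E.
Proof. by rewrite /primitive_inverse integralE. Qed.

Let M_nd : {homo M : x y / x <= y >-> (x <= y)%E}.
Proof.
move=> x y xy; apply: ge0_subset_integral => //; first exact: measurable_funTS.
by apply: subset_itvl; rewrite bnd_simp.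
Qed.

Let split_itv (g : R -> \bar R) (a y : R) : 0 <= a <= y ->
  measurable_fun setT g -> (forall u, (0 <= g u)%E) ->
  (\int[lebesgue_measure]_(u in `[0%R, y]) g u =
   \int[lebesgue_measure]_(u in `[0%R, a]) g u +
   \int[lebesgue_measure]_(u in `]a, y]) g u)%E.
Proof.
move=> /andP[a0 ay] mg g0.
have -> : `[0, y]%classic = `[0, a]%classic `|` `]a, y]%classic :> set R.
  by rewrite -itv_bndbnd_setU// bnd_simp.
rewrite ge0_integral_setU//; first exact: measurable_funTS.
rewrite disj_set2E; apply/eqP; rewrite -subset0 => u [] /=.
rewrite !in_itv /= => /andP[_ ua] /andP[au _].
by move: au; rewrite ltNge ua.
Qed.

(* If the integral of h^\- over some [0, y] diverges, the primitive is -oo from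
   there on, since +oo - +oo = -oo.  Otherwise h <= 0 on [0, +oo[, as a positive
   value of h would make the primitive eventually positive. *)
Lemma primitive_inverse_ext_pinfty (l : R) : l <= 0 ->
  (forall n : nat, (primitive_inverse F n%:R <= l%:E * n%:R%:E)%E) ->
  (primitive_inverse_ext F +oo <= l%:E * +oo)%E.
Proof.
move=> l0 phin; rewrite /primitive_inverse_ext.
have [[y0 My0]|Mfin] := pselect (exists y, M y = +oo%E).
  have -> : lim (primitive_inverse F y @[y --> +oo]) = -oo%E.
    apply/cvg_lim => //; apply: cvg_near_cst.
    near=> y; rewrite phiE.
    have -> : M y = +oo%E.
      by apply/eqP; rewrite -leye_eq -My0; apply: M_nd; near: y;
        exact: nbhs_pinfty_ge (num_real _).
    by rewrite addeNy.
  exact: leNye.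
have {}Mfin y : (M y < +oo)%E by rewrite ltey; apply/eqP => My; apply: Mfin; exists y.
have M0 y : (0 <= M y)%E by apply: integral_ge0.
have [[a [a0 ha]]|hle] := pselect (exists a, 0 <= a /\ (0 < h a)%E).
  exfalso.
  (* Since [h a] may be +oo, a real lower bound [c] is extracted. By monotonicity it holds beyond
     [a], where [M] stops growing and [P] grows with slope at least [c]. *)
  have [c c0 hc] : exists2 c : R, 0 < c & (c%:E <= h a)%E.
    move: ha; case: (h a) => [r r0| _|//]; first by exists r.
    by exists 1 => //; exact: leey.
  have hge u : a < u -> (c%:E <= h u)%E.
    by move=> au; rewrite (le_trans hc)// upper_inverse_nd// ltW.
  have ME y : a <= y -> M y = M a.
    move=> ay; rewrite /M (@split_itv _ a y)//; last by rewrite a0.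
    rewrite [X in (_ + X)%E](_ : _ = 0)%E ?adde0//.
    rewrite (eq_integral (cst 0%E)) ?integral0// => u.
    rewrite inE /= in_itv /= => /andP[au _].
    rewrite funenegE; apply/max_idPr; rewrite leeNl oppe0.
    by rewrite (le_trans _ (hge _ au))// lee_fin ltW.
  have Pge y : a <= y -> ((c * (y - a))%:E <= P y)%E.
    move=> ay; rewrite /P (@split_itv _ a y)//; last by rewrite a0.
    apply: (@le_trans _ _ (\int[lebesgue_measure]_(u in `]a, y]) (cst c%:E) u)%E).
      rewrite integral_cst// /= lebesgue_measure_itv /= lte_fin.
      case: ltP => [_|ya]; first by rewrite -EFinB -EFinM.
      have -> : y = a by apply/eqP; rewrite eq_le ya ay.
      by rewrite subrr mulr0 mule0.
    rewrite -[leLHS]add0e leeD//; first exact: integral_ge0.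
    apply: ge0_le_integral => //.
    - by move=> u _; rewrite lee_fin ltW.
    - exact: measurable_funTS.
    - move=> u /=; rewrite in_itv /= => /andP[au _].
      by rewrite funeposE le_max hge.
  pose K := fine (M a).
  have KE : M a = K%:E by rewrite fineK// ge0_fin_numE.
  have K0 : 0 <= K by rewrite -lee_fin -KE.
  (* This size makes [c * (n - a) > K], hence [P n - M n > 0], against the bound [l * n <= 0]. *)
  pose n := (Num.bound (a + (K + 1) / c)).
  have an : a + (K + 1) / c < n%:R.
    by apply: archi_boundP; rewrite addr_ge0// divr_ge0 ?addr_ge0// ltW.
  have Kc0 : 0 <= (K + 1) / c by rewrite divr_ge0 ?addr_ge0// ltW.
  have an' : a <= n%:R by rewrite (le_trans _ (ltW an))// lerDl.
  have := phin n; rewrite phiE ME// KE -EFinM => H.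
  have : ((c * (n%:R - a))%:E - K%:E <= (l * n%:R)%:E)%E.
    by rewrite (le_trans _ H)// leeB// Pge.
  rewrite -EFinB lee_fin leNgt => /negP; apply.
  rewrite (@le_lt_trans _ _ 0)//.
    by rewrite mulr_le0_ge0.
  rewrite subr_gt0 (@lt_le_trans _ _ (K + 1))// ?ltrDl//.
  by rewrite mulrC -ler_pdivrMr// lerBrDl ltW.
have P0 y : P y = 0%E.
  rewrite /P (eq_integral (cst 0%E)) ?integral0// => u.
  rewrite inE /= in_itv /= => /andP[u0 _].
  rewrite funeposE; apply/max_idPr; rewrite leNgt; apply/negP => hu.
  by apply: hle; exists u.
(* With [P = 0] the primitive is [- M], which is nonincreasing, so its limit is the infimum of its
   values. *)
have phi_ninc : {homo primitive_inverse F : x y / x <= y >-> (y <= x)%E}.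
  by move=> x y xy; rewrite !phiE !P0 leeB// M_nd.
rewrite (cvg_lim _ (nonincreasing_cvge phi_ninc))//.
have infle (n : nat) : (ereal_inf (range (primitive_inverse F)) <= (l * n%:R)%:E)%E.
  by rewrite EFinM (le_trans _ (phin n))//; apply: ereal_inf_lbound; exists n%:R.
(* For [l = 0] the product with +oo is [0], and the value at [0] already gives the bound. For
   [l < 0] the infimum must be -oo: a real infimum [r] is undercut by [l * n] once [n] exceeds |r| /
   (- l). *)
move: l0; rewrite le_eqVlt => /predU1P[l0|l0].
  by have := infle 0%N; rewrite l0 mul0e mulr0.
rewrite mulry ltr0_sg// mulN1e leNgt; apply/negP => infN.
have infoo : (ereal_inf (range (primitive_inverse F)) < +oo)%E.
  by rewrite (le_lt_trans (infle 0%N))// ltry.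
have infE := @fineK _ (ereal_inf (range (primitive_inverse F))).
set r := fine _ in infE.
have {}infE : ereal_inf (range (primitive_inverse F)) = r%:E.
  by rewrite -infE// fin_numElt infN.
pose n := Num.bound (`|r| / - l).
have nr : `|r| / - l < n%:R.
  by apply: archi_boundP; rewrite divr_ge0// oppr_ge0 ltW.
have := infle n; rewrite infE lee_fin leNgt => /negP; apply.
rewrite ltr_pdivrMr ?oppr_gt0// mulrN in nr.
by have := ler_norm (- r); rewrite normrN; lra.
Unshelve. all: by end_near. Qed.

End primitive_at_infinity.

(** * Restriction to [Om] and comparison with the spectral distribution *)

Section restriction.
Context d (X : measurableType d) (R : realType).
Variables (mu : {measure set X -> \bar R}) (V : separableHilbertType R).
Local Notation ip := (innerL2 mu V).
Local Notation L2 := (L2 mu V).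

Lemma eq_dotL2 (u v w : L2) :
  {ae mu, forall x, inner (fun_of_L2 u x) (fun_of_L2 v x) =
                    inner (fun_of_L2 u x) (fun_of_L2 w x)} ->
  ip u v = ip u w.
Proof.
move=> uvw; apply/eqP; rewrite eq_complex; apply/andP; split; apply/eqP.
  apply: ae_eq_Rintegral; do ?exact: inner_Re_integrable (fun_of_L2P _) (fun_of_L2P _).
  by apply: filterS uvw => x ->.
apply: ae_eq_Rintegral; do ?exact: inner_Im_integrable (fun_of_L2P _) (fun_of_L2P _).
by apply: filterS uvw => x ->.
Qed.

Lemma dot_mul_indic (Om : set X) (u w : L2) : measurable Om ->
  supported_in Om u -> ip u (mul_indic Om w) = ip u w.
Proof.
move=> mO su; apply: eq_dotL2; apply: filterS2 su (mul_indicE w mO) => x u0 ->.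
have [Ox|nOx] := pselect (Om x); first by rewrite indicE mem_set// scale1r.
by rewrite u0// !linear0l.
Qed.

Lemma supported_mul_indic (Om : set X) (w : L2) : measurable Om ->
  supported_in Om (mul_indic Om w).
Proof.
move=> mO; apply: filterS (mul_indicE w mO) => x -> nOx.
by rewrite indicE memNset// scale0r.
Qed.

(** [fun_of_L2] picks an unknown representative of the class [0]; that it vanishes almost everywhere
    follows from additivity at [0 + 0]. *)
Lemma supported_in0 (Om : set X) : supported_in Om (0 : L2).
Proof.
have := fun_of_L2_lin 1 (0 : L2) 0; rewrite scale1r addr0.
apply: filterS => x + _; rewrite scale1r => /(congr1 (fun z => z - fun_of_L2 (0 : L2) x)).
by rewrite subrr addrK.
Qed.

(** Parseval in [B] is applied to each [P (f i)], and the two sums are exchanged. For fixed [e],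
    with [z = mul_indic Om (P e)], the coefficient of [P (f i)] along [e] has the modulus of
    [ip z (f i)]. Bessel bounds the sum over [i] by |z|^2, which is the diagonal entry of the trace
    at [e]. *)
Lemma sum_spectral_le (E : projection_valued_measure ip) (B : set L2)
    (Om : set X) (n : nat) (f : nat -> L2) (t : R) :
  orthonormal_basis ip B -> measurable Om ->
  orthonormal_on ip (index_iota 0 n) f -> (forall i, supported_in Om (f i)) ->
  (\sum_(i < n) scalar_measure E (f i) `]-oo, t[%classic
    <= spectral_distribution E B Om t)%E.
Proof.
move=> oB mO orf sf; rewrite /spectral_distribution /op_trace.
have mt : measurable (`]-oo, t[%classic : set (measurableTypeR R)).
  exact: measurable_itv.
have [linP idP symP] := pvm_proj E mt.
set P := E `]-oo, t[%classic in linP idP symP *.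
apply: (@le_trans _ _ (\sum_(i < n) \esum_(e in B)
    (Re (`|ip (P (f i)) e| ^+ 2))%:E)%E).
  by apply: lee_sum => i _; exact: parseval_le.
rewrite -esum_sum; last first.
  by move=> *; rewrite lee_fin ge0_cRe// exprn_ge0.
apply: le_esum => e _; rewrite sumEFin lee_fin -cRe_sum.
rewrite symP -(dot_mul_indic (P e) mO (supported_mul_indic _ mO)).
set z := mul_indic Om (P e).
have fz i : `|ip (P (f i)) e| = `|ip z (f i)|.
  by rewrite symP -(dot_mul_indic (P e) mO (sf i)) dot_conj norm_conjC.
under eq_bigr do rewrite fz.
have := bessel (iota_uniq _ _) orf z; rewrite big_mkord lecE => /andP[_].
exact.
Qed.

End restriction.

(** * Signed integrals against finite sums of measures *)

Section measure_sum.
Context d (T : measurableType d) (R : realType).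
Variable m_ : {measure set T -> \bar R}^nat.

(** Integrability makes the integrals of the positive and negative parts finite, so their difference
    can be taken term by term. *)
Lemma integral_measure_sum (D : set T) (f : T -> \bar R) : measurable D ->
  (forall k, (m_ k).-integrable D f) -> forall n,
  (\int[msum m_ n]_(x in D) f x = \sum_(k < n) \int[m_ k]_(x in D) f x)%E.
Proof.
move=> mD If n; have mf := measurable_int _ (If 0%N).
have mfp := measurable_funepos mf; have mfn := measurable_funeneg mf.
rewrite integralE !ge0_integral_measure_sum//.
have pE k := fineK (integrable_pos_fin_num mD (If k)).
have nE k := fineK (integrable_neg_fin_num mD (If k)).
have sE (g : nat -> \bar R) : (forall k, (fine (g k))%:E = g k) ->
    (\sum_(k < n) g k)%E = (\sum_(k < n) fine (g k))%:E.
  by move=> gE; rewrite -sumEFin; apply: eq_bigr => k _; rewrite gE.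
rewrite (sE _ pE) (sE _ nE) -EFinB -sumrB -sumEFin; apply: eq_bigr => k _.
by rewrite EFinB pE nE -integralE.
Qed.

End measure_sum.

(** * Admissible families and the sum of their spectral measures *)

Section admissible.
Context d (X : measurableType d) (R : realType).
Variables (mu : {measure set X -> \bar R}) (V : separableHilbertType R).
Local Notation ip := (innerL2 mu V).
Local Notation L2 := (L2 mu V).
Variables (E : projection_valued_measure ip) (Om : set X) (lambda : R).

(** The family is a sequence because [msum] sums along sequences of measures; only orthonormality is
    restricted to indices below [n]. *)
Definition admissible_family (n : nat) (f : nat -> L2) : Prop :=
  [/\ orthonormal_on ip (index_iota 0 n) f,
      forall i, supported_in Om (f i),
      forall i, form_dom E (f i) &
      forall i, energy E (f i) <= lambda * hnorm ip (f i) ^+ 2].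

Lemma scalar_measure0_integral (g : R -> \bar R) :
  (\int[scalar_measure E 0%R]_t g t = 0)%E.
Proof.
rewrite (eq_measure_integral mzero) ?integral_measure_zero// => A mA _.
have [linP _ _] := pvm_proj E mA.
rewrite /= /scalar_measure (_ : E A 0 = 0) ?linear0l//.
have := linP 1 0 0; rewrite !scale1r addr0 => E0.
by apply: (addrI (E A 0)); rewrite -E0 addr0.
Qed.

Lemma form_dom0 : form_dom E 0.
Proof.
apply/integrableP; split; first exact: EFin_measurable.
by rewrite scalar_measure0_integral.
Qed.

Lemma energy0 : energy E 0 = 0.
Proof. by rewrite /energy /Rintegral scalar_measure0_integral. Qed.

(** Dimensions are natural numbers, so a finite supremum is attained, and an infinite one yields
    arbitrarily many independent vectors. Gram-Schmidt turns these into admissible families, since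
    the support and energy conditions hold on all of [L]. *)
Lemma dirichlet_distribution_dim :
  (exists (n : nat) f,
     dirichlet_distribution E Om lambda = n%:R%:E /\ admissible_family n f) \/
  (dirichlet_distribution E Om lambda = +oo%E /\
   forall n, exists f, admissible_family n f).
Proof.
set N := dirichlet_distribution E Om lambda.
pose adm n := exists f, admissible_family n f.
have admP L n (v : 'I_n -> L2) : linear_subspace L ->
    (forall u, L u -> supported_in Om u) ->
    (forall u, L u -> form_dom E u /\ energy E u <= lambda * hnorm ip u ^+ 2) ->
    (forall i, L (v i)) -> lin_indep v -> forall k, (k <= n)%N -> adm k.
  move=> sL suppL eL Lv iv k kn.
  have [f Lf orf] := gram_schmidt ip sL Lv iv kn.
  exists f; split => // i; first exact: suppL.
    exact: (eL _ (Lf i)).1.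
  exact: (eL _ (Lf i)).2.
have Ngt (x : \bar R) : (x < N)%E ->
    exists n : nat, [/\ (x < n%:R%:E)%E, (n%:R%:E <= N)%E &
      forall k, (k <= n)%N -> adm k].
  move=> /ereal_sup_gt[_ [L [sL suppL eL] <-]] xL.
  have LN : (hdim L <= N)%E by apply: ereal_sup_ubound; exists L.
  move: xL => /ereal_sup_gt[_ [n [v [Lv iv]] <-] xn].
  exists n; split => //; last exact: (admP L n v).
  by apply: le_trans LN; apply: ereal_sup_ubound; exists n => //; exists v.
(* The zero subspace competes, which excludes the value -oo. *)
have N0 : (0 <= N)%E.
  apply: (@le_trans _ _ (hdim (U := L2) [set 0])).
    apply: ereal_sup_ubound; exists 0%N => //; exists (fun=> 0).
    by split => // a _ [].
  apply: ereal_sup_ubound; exists [set 0] => //; split.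
  - by split => // a u v -> ->; rewrite scaler0 addr0.
  - by move=> u ->; exact: supported_in0.
  - move=> u ->; split; first exact: form_dom0.
    by rewrite energy0 hnorm_sqr linear0l /= mulr0.
have [NE|Noo] := eqVneq N +oo%E.
  right; split => // n; have : (n%:R%:E < N)%E by rewrite NE ltry.
  by move=> /Ngt[m [nm _]]; apply; move: nm; rewrite lte_fin ltr_nat => /ltnW.
left; have Nfin : N \is a fin_num by rewrite ge0_fin_numE// ltey.
(* A natural number [n] with [N - 1 < n <= N] must equal [N]: otherwise some larger number, at least
   [n + 1 > N], would still be bounded by [N]. *)
have : (N - 1%:E < N)%E by rewrite lteBlDr// lteDl.
move=> /Ngt[n [Nn nN An]].
have [f Af] := An n (leqnn n).
exists n, f; split => //; apply/eqP; rewrite eq_le nN andbT leNgt.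
apply/negP => /Ngt[m [nm mN _]].
have : (n.+1%:R%:E <= N)%E.
  by rewrite (le_trans _ mN)// lee_fin ler_nat -(ltr_nat R) -lte_fin.
rewrite -natr1 EFinD leNgt => /negP; apply.
by rewrite -lteBlDr.
Qed.

Section family_measure.
Variables (n : nat) (f : nat -> L2).
Hypothesis admf : admissible_family n f.

Definition family_measure : {measure set (measurableTypeR R) -> \bar R} :=
  msum (fun k => scalar_measure E (f k)) n.

Lemma family_measureT : family_measure setT = n%:R%:E.
Proof.
have [orf _ _ _] := admf.
rewrite /family_measure /= /msum (eq_bigr (fun=> 1%:E)).
  by rewrite sumEFin sumr_const card_ord.
move=> i _; rewrite /= /scalar_measure pvmT orf ?mem_index_iota ?ltn_ord//.
by rewrite eqxx.
Qed.

Lemma family_measure_integral :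
  (\int[family_measure]_t t%:E <= (lambda * n%:R)%:E)%E.
Proof.
have [orf _ If Ef] := admf.
rewrite integral_measure_sum//.
have IE k : (\int[scalar_measure E (f k)]_t t%:E)%E = (energy E (f k))%:E.
  rewrite /energy /Rintegral fineK//; exact (integrable_fin_num measurableT (If k)).
under eq_bigr do rewrite IE.
rewrite sumEFin lee_fin (@le_trans _ _ (\sum_(i < n) lambda))//.
  apply: ler_sum => i _; rewrite (le_trans (Ef i))//.
  by rewrite hnorm_sqr orf ?mem_index_iota ?ltn_ord// eqxx mulr1.
by rewrite sumr_const card_ord mulr_natr.
Qed.

Lemma family_measure_le (B : set L2) t : orthonormal_basis ip B ->
  measurable Om ->
  (family_measure `]-oo, t[%classic <= spectral_distribution E B Om t)%E.
Proof.
by have [orf sf _ _] := admf => oB mO; exact: sum_spectral_le.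
Qed.

End family_measure.

End admissible.

(** * Positivity of [A] and the support of its spectral measure *)

Lemma neg_interval_moments (R : realType)
    (s : {measure set (measurableTypeR R) -> \bar R}) (k c m : R) :
  s setT = m%:E -> s (~` `[- k, - c]%classic) = 0%E -> 0 <= c -> c <= k ->
  (\int[s]_t (t ^+ 2)%:E < +oo)%E /\
  exists J : R, (\int[s]_t t%:E)%E = (- J)%:E /\ c * m <= J.
Proof.
set S := `[- k, - c]%classic => sT sS c0 ck.
have mS : measurable (S : set (measurableTypeR R)) by exact: measurable_itv.
have FF : Filter (nbhs (almost_everywhere s)) by exact: ae_filter_ringOfSetsType s.
(* Almost everywhere [c <= |t| <= k] and [t = - |t|]: the upper bound makes both moments finite, and
   the lower bound gives [c * m <= J]. *)
have aeS : {ae s, forall t, S t}.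
  by exists (~` S); split => //; exact: measurableC.
have k0 : 0 <= k by exact: le_trans ck.
have absle t : S t -> c <= `|t| <= k.
  rewrite /S /= in_itv /= => /andP[kt tc].
  rewrite ler0_norm; first by rewrite lerNr tc lerNl kt.
  by rewrite (le_trans tc)// oppr_le0.
have mE : measurable_fun [set: measurableTypeR R] (EFin : _ -> \bar R).
  exact: EFin_measurable.
have mabs : measurable_fun [set: measurableTypeR R] (fun t : R => `|t%:E|%E).
  exact: measurableT_comp.
split.
  apply: (@le_lt_trans _ _ (\int[s]_t (cst (k ^+ 2)%:E) t)%E); last first.
    by rewrite integral_cst// sT -EFinM ltry.
  apply: ae_ge0_le_integral => //.
  - by move=> t _; rewrite lee_fin sqr_ge0.
  - by apply/measurable_EFinP; apply: measurable_funX; exact: measurable_id.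
  - by move=> t _; rewrite lee_fin sqr_ge0.
  - apply: filterS aeS => t /absle/andP[_ tk] _.
    by rewrite lee_fin -[leLHS]ger0_norm ?sqr_ge0// normrX ler_sqr ?nnegrE.
pose J := (\int[s]_t `|t%:E|)%E.
have tE : (\int[s]_t t%:E = - J)%E.
  rewrite /J -integral_ge0N//; apply: ae_eq_integral => //.
    exact: measurableT_comp.
  apply: filterS aeS => t; rewrite /S /= in_itv /= => /andP[_ tc] _.
  by rewrite ler0_norm ?opprK// (le_trans tc)// oppr_le0.
have J0 : (0 <= J)%E by exact: integral_ge0.
have Joo : (J < +oo)%E.
  apply: (@le_lt_trans _ _ (\int[s]_t (cst k%:E) t)%E); last first.
    by rewrite integral_cst// sT -EFinM ltry.
  apply: ae_ge0_le_integral => //.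
  by apply: filterS aeS => t /absle/andP[_ tk] _; rewrite lee_fin.
have JE : (fine J)%:E = J by rewrite fineK// ge0_fin_numE.
exists (fine J); split; first by rewrite tE -JE.
rewrite -lee_fin EFinM JE -sT -integral_cst//.
apply: ae_ge0_le_integral => //.
by apply: filterS aeS => t /absle/andP[ct _] _; rewrite lee_fin.
Qed.

Section spectral_support.
Context (R : realType) (U : lmodType R[i]) (ip : {dot U for (@Num.conj R[i])}).
Variables (A : unbounded_op U) (E : projection_valued_measure ip).
Hypothesis AE : spectral_measure_of A E.

Lemma scalar_measure_pvm (S T : set (measurableTypeR R)) u :
  measurable S -> measurable T ->
  scalar_measure E (E S u) T = scalar_measure E u (T `&` S).
Proof. by move=> mS mT; rewrite /scalar_measure pvmI. Qed.

(** Localizing [u] in a bounded spectral interval puts it in the domain, where the sign of [A] can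
    be tested: the finite second moment gives membership, and the first moment is the value of the
    quadratic form. *)
Lemma form_neg_interval (k c : R) (u : U) : 0 <= c -> c <= k ->
  let w := E `[- k, - c]%classic u in
  dom A w /\ exists J : R, ip (A w) w = (- J)%:C%C /\ c * Re (ip w w) <= J.
Proof.
move=> c0 ck w.
have mS : measurable (`[- k, - c]%classic : set (measurableTypeR R)).
  exact: measurable_itv.
have sT : scalar_measure E w setT = (Re (ip w w))%:E.
  by rewrite /scalar_measure pvmT.
have sS : scalar_measure E w (~` `[- k, - c]%classic) = 0%E.
  rewrite scalar_measure_pvm//; last exact: measurableC.
  by rewrite setICl; exact: scalar_measure0.
have [w2 [J [wJ cJ]]] := neg_interval_moments sT sS c0 ck.
have dw : dom A w by apply/AE.1.
split => //; exists J; split => //.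
by rewrite (AE.2 _ dw) /Rintegral wJ.
Qed.

(** The negative half line is exhausted by intervals at positive distance from [0]. For the vector
    [w] localized in one of them, c |w|^2 <= J = - <A w, w> <= 0 with [c > 0], so [w] vanishes. *)
Lemma nonneg_spectral0 u : nonneg_op ip A ->
  scalar_measure E u `]-oo, 0[%classic = 0%E.
Proof.
move=> A0; apply/negligibleP; first exact: measurable_itv.
pose F (k : nat) : set (measurableTypeR R) := `[- k.+1%:R, - k.+1%:R^-1]%classic.
have -> : `]-oo, 0[%classic = \bigcup_k F k.
  apply/seteqP; split => [t /=|t [k _]]; rewrite /F /= !in_itv /=.
    move=> t0; have t0' : 0 < - t by rewrite oppr_gt0.
    (* The first bound places [t] to the right of the left endpoint, the second to the left of the
       right endpoint. *)
    pose k := maxn (Num.bound (- t)) (Num.bound (- t)^-1).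
    exists k => //=; rewrite in_itv /= lerNl lerNr.
    have b1 : - t < k%:R.
      rewrite (lt_le_trans (archi_boundP (ltW t0')))// ler_nat leq_maxl.
      by [].
    have b2 : (- t)^-1 < k%:R.
      have i0 : 0 <= (- t)^-1 by rewrite invr_ge0 ltW.
      by rewrite (lt_le_trans (archi_boundP i0))// ler_nat leq_maxr.
    rewrite (le_trans (ltW b1)) ?ler_nat//=.
    rewrite -[leRHS]invrK lef_pV2 ?posrE ?invr_gt0//.
    by rewrite (le_trans (ltW b2))// ler_nat.
  by move=> /andP[_ /le_lt_trans]; apply; rewrite oppr_lt0 invr_gt0.
apply: negligible_bigcup => k; apply/negligibleP; first exact: measurable_itv.
have c0 : (0 : R) <= k.+1%:R^-1 by rewrite invr_ge0.
have ck : k.+1%:R^-1 <= k.+1%:R :> R.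
  by rewrite (@le_trans _ _ 1)// ?invf_le1// ?ler1n.
have [dw [J [AJ Jw]]] := form_neg_interval u c0 ck.
have := A0 _ dw; rewrite AJ lecE /= oppr_ge0 => /andP[_ J0].
rewrite /= /scalar_measure; congr EFin; apply/eqP; rewrite eq_le.
rewrite ge0_cRe ?dnorm_ge0// andbT.
have k0 : 0 < (k.+1%:R^-1 : R) by rewrite invr_gt0.
by rewrite -(pmulr_rle0 _ k0) (le_trans Jw).
Qed.

(** Here the intervals may touch [0]: if the localized vector is nonzero, strict positivity
    contradicts [0 <= J], which is the estimate at [c = 0]. *)
Lemma posdef_spectral0 u : posdef_op ip A ->
  scalar_measure E u `]-oo, 0]%classic = 0%E.
Proof.
move=> A0; apply/negligibleP; first exact: measurable_itv.
(* The endpoint is written [- 0] to match [form_neg_interval] at [c = 0]. *)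
pose F (k : nat) : set (measurableTypeR R) := `[- k%:R, - 0]%classic.
have -> : `]-oo, 0]%classic = \bigcup_k F k.
  apply/seteqP; split => [t /=|t [k _]]; rewrite /F /= !in_itv /= ?oppr0; last first.
    by case/andP.
  move=> t0; exists (Num.bound (- t)) => //=; rewrite in_itv /= ?oppr0 t0 lerNl andbT.
  by rewrite ltW// archi_boundP// oppr_ge0.
apply: negligible_bigcup => k; apply/negligibleP; first exact: measurable_itv.
have [dw [J [AJ Jw]]] := form_neg_interval u (lexx 0) (ler0n _ k).
rewrite /= /scalar_measure; have [->|w0] := eqVneq (E (F k) u) 0.
  by rewrite linear0l.
have := A0 _ dw w0; rewrite AJ ltcE /= oppr_gt0 => /andP[_].
by rewrite mul0r in Jw; rewrite ltNge Jw.
Qed.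

End spectral_support.

(** * Markov's inequality and the bound at [2 * lambda] *)

Lemma markov_nonneg (R : realType) (nu : {measure set (measurableTypeR R) -> \bar R})
    (x : R) : nu `]-oo, 0[%classic = 0%E -> 0 < x ->
  (x%:E * nu (~` `]-oo, x[%classic) <= \int[nu]_t t%:E)%E.
Proof.
move=> nu0 x0.
have mE : measurable_fun [set: measurableTypeR R] (EFin : _ -> \bar R).
  exact: EFin_measurable.
have mabs : measurable_fun [set: measurableTypeR R] (fun t : R => `|t%:E|%E).
  exact: measurableT_comp.
(* As [nu] does not charge the negative half line, [t = |t|] almost everywhere, and Markov's
   inequality for |t| applies. *)
have -> : (\int[nu]_t t%:E = \int[nu]_t `|t%:E|)%E.
  apply: ae_eq_integral => //.
  exists `]-oo, 0[%classic; split => //.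
  move=> t /=; rewrite in_itv /= ltNge => nt; apply/negP => t0; apply: nt => _.
  by rewrite ger0_norm.
apply: le_trans (le_integral_abse nu measurableT mE x0).
rewrite setTI lee_pmul2l// le_measure ?inE//.
- by apply: measurableC; exact: measurable_itv.
- have := mabs measurableT _ (emeasurable_itv `[x%:E, +oo[); rewrite setTI.
  by congr measurable; apply/seteqP; split => t /=; rewrite in_itv /= andbT.
- move=> t /=; rewrite in_itv /= => /negP; rewrite -leNgt lee_fin => xt.
  by rewrite (le_trans xt)// ler_norm.
Qed.

Lemma admissible_family_le d (X : measurableType d) (R : realType)
    (mu : {measure set X -> \bar R}) (V : separableHilbertType R)
    (A : unbounded_op (L2 mu V)) (E : projection_valued_measure (innerL2 mu V))
    (B : set (L2 mu V)) (Om : set X) (lambda : R) (n : nat) (f : nat -> L2 mu V) :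
  spectral_measure_of A E -> orthonormal_basis (innerL2 mu V) B ->
  measurable Om -> admissible_family E Om lambda n f ->
  (nonneg_op (innerL2 mu V) A /\ lambda != 0 \/ posdef_op (innerL2 mu V) A) ->
  (n%:R%:E <= 2%:E * spectral_distribution E B Om (2 * lambda))%E.
Proof.
move=> AE oB mO admf pos.
have nn : nonneg_op (innerL2 mu V) A.
  case: pos => [[]//|pA u du]; have [->|u0] := eqVneq u 0.
    by rewrite linear0r.
  exact/ltW/pA.
pose nu := family_measure E n f.
have nuT : nu setT = n%:R%:E := family_measureT admf.
have nu0 : nu `]-oo, 0[%classic = 0%E.
  rewrite /nu /family_measure /= /msum big1// => i _.
  exact: (nonneg_spectral0 AE).
have nuI := family_measure_integral admf.
have nuF : (nu `]-oo, (2 * lambda)%R[%classic <=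
    spectral_distribution E B Om (2 * lambda))%E.
  exact: (family_measure_le admf).
have F0 : (0 <= spectral_distribution E B Om (2 * lambda))%E.
  exact: le_trans (measure_ge0 nu _) nuF.
have mrk x (x0 : 0 < x) := le_trans (markov_nonneg nu0 x0) nuI.
have mC x : measurable (~` `]-oo, x[%classic : set (measurableTypeR R)).
  by apply: measurableC; exact: measurable_itv.
have nuU x : (n%:R%:E <= nu `]-oo, x[%classic + nu (~` `]-oo, x[%classic))%E.
  rewrite -nuT -(setUv `]-oo, x[%classic) measureU2//; exact: measurable_itv.
have nufin S : measurable S -> nu S \is a fin_num.
  move=> mS; rewrite ge0_fin_numE//.
  by rewrite (@le_lt_trans _ _ (nu setT))// ?le_measure ?inE// nuT ltry.
have [l0|l0|l0] := ltgtP lambda 0; last first.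
(* At [lambda = 0] strict positivity is in force. The first moment is at most [0], so Markov removes
   all mass from []0, +oo[], while []-oo, 0]] carries none; hence [n = 0]. *)
- case: pos => [[_]|pA]; first by rewrite l0 eqxx.
  have nu0' : nu `]-oo, 0]%classic = 0%E.
    rewrite /nu /family_measure /= /msum big1// => i _.
    exact: (posdef_spectral0 AE).
  have nuk x : 0 < x -> nu (~` `]-oo, x[%classic) = 0%E.
    move=> x0; apply/eqP; rewrite eq_le measure_ge0 andbT.
    by have := mrk _ x0; rewrite l0 mul0r pmule_rle0.
  have : nu setT = 0%E.
    apply/negligibleP => //.
    have -> : setT = `]-oo, 0]%classic `|`
        \bigcup_k (~` `]-oo, k.+1%:R^-1[%classic) :> set (measurableTypeR R).
      apply/esym; rewrite -subTset => t _; have [t0|t0] := leP t 0.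
        by left; rewrite /= in_itv.
      right; have [k _ H] := near_infty_natSinv_lt (PosNum t0).
      exists k => //=; rewrite in_itv /= => /lt_trans /(_ (H k (leqnn k))).
      by rewrite /= ltxx.
    apply: negligibleU.
      by apply/negligibleP => //; exact: measurable_itv.
    apply: negligible_bigcup => k; apply/negligibleP; first exact: mC.
    by apply: nuk; rewrite invr_gt0.
  by rewrite nuT => ->; rewrite mule_ge0.
(* For [lambda > 0], Markov at [2 * lambda] leaves at most half of the mass [n] above that level,
   hence at least [n / 2] below it. *)
- have ll0 : 0 < 2 * lambda by rewrite mulr_gt0.
  have := mrk _ ll0; have := nuU (2 * lambda); rewrite -/nu in nuF.
  move: nuF; set F := spectral_distribution _ _ _ _.
  rewrite -(fineK (nufin _ (mC (2 * lambda)))).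
  rewrite -(fineK (nufin `]-oo, (2 * lambda)[%classic (measurable_itv _))).
  set g := fine _; set h := fine _ => gF.
  rewrite -EFinD -EFinM !lee_fin -mulrA [2 * _]mulrCA ler_pM2l// => ngh h2n.
  apply: (@le_trans _ _ (2%:E * g%:E)%E); last by rewrite lee_pmul2l.
  by rewrite -EFinM lee_fin; lra.
(* For [lambda < 0] the bound [lambda * n] dominates a nonnegative quantity, which forces
   [n = 0]. *)
- have H := mrk 1 ltr01.
  have : (0%:E <= (lambda * n%:R)%:E)%E.
    by apply: le_trans H; rewrite mule_ge0.
  rewrite lee_fin nmulr_rge0// => n0.
  by rewrite (@le_trans _ _ 0%E)// ?lee_fin// mule_ge0.
Qed.

Theorem corollary1p3 (R : realType) (d : measure_display)
    (X : measurableType d) (mu : {sigma_finite_measure set X -> \bar R})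
    (V : separableHilbertType R)
    (A : unbounded_op (L2 mu V))
    (E : projection_valued_measure (innerL2 mu V))
    (B : set (L2 mu V)) (Om : set X) (lambda : R) :
  self_adjoint (innerL2 mu V) A ->
  spectral_measure_of A E ->
  orthonormal_basis (innerL2 mu V) B ->
  measurable Om ->
  let N := dirichlet_distribution E Om lambda in
  let F := spectral_distribution E B Om in
  (primitive_inverse_ext F N <= lambda%:E * N)%E /\
  (nonneg_op (innerL2 mu V) A -> lambda != 0 ->
    (N <= 2%:E * F (2 * lambda)%R)%E) /\
  (posdef_op (innerL2 mu V) A ->
    (N <= 2%:E * F (2 * lambda)%R)%E).
Proof.
move=> _ AE oB mO N F.
have NF : (nonneg_op (innerL2 mu V) A /\ lambda != 0 \/ posdef_op (innerL2 mu V) A) ->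
    (N <= 2%:E * F (2 * lambda)%R)%E.
  move=> pos; have nF n f (admf : admissible_family E Om lambda n f) :=
    admissible_family_le AE oB mO admf pos.
  have [[n [f [NE /nF]]]|[NE admN]] := dirichlet_distribution_dim E Om lambda.
    by rewrite /N NE.
  (* Families of every size make [2 * F] at least every natural number, hence infinite. *)
  rewrite /N NE leye_eq; apply/eqP/eqyP => a a0.
  have [f /nF] := admN (Num.bound a); apply: le_trans.
  by rewrite lee_fin ltW// archi_boundP// ltW.
split; last by split => [nA l0|pA]; apply: NF; [left|right].
have phin n f : admissible_family E Om lambda n f ->
    (primitive_inverse F n%:R <= (lambda * n%:R)%:E)%E.
  move=> admf; apply: le_trans (family_measure_integral admf).
  apply: integral_upper_inverse_le; first exact: (family_measureT admf).
  by move=> x; exact: (family_measure_le admf).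
have [[n [f [NE /phin]]]|[NE admN]] := dirichlet_distribution_dim E Om lambda.
  by rewrite /N NE /=.
(* For [lambda > 0] the right-hand side is +oo. Otherwise the bounds at all natural numbers pass to
   the limit. *)
rewrite /N NE; have [l0|l0] := leP lambda 0; last first.
  by rewrite mulry gtr0_sg// mul1e leey.
apply: primitive_inverse_ext_pinfty => // n.
by have [f /phin] := admN n; rewrite EFinM.
Qed.
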